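(* Let $(\sigma_n)_{n\ge1}$ be a conjugation invariant sequence of random permutations. If $\#(\sigma_n)/\sqrt n\to0$ in probability as $n\to\infty$, then $$\frac{\mathrm{LIS}(\sigma_n)}{\sqrt n}\xrightarrow[n\to\infty]{\mathbb{P}}2\quad\text{and}\quad\frac{\mathrm{LDS}(\sigma_n)}{\sqrt n}\xrightarrow[n\to\infty]{\mathbb{P}}2.$$ Moreover, for any $p\in[1,\infty)$, if $\#(\sigma_n)/\sqrt n\to0$ in $\mathbb{L}^p$, then $$\frac{\mathrm{LIS}(\sigma_n)}{\sqrt n}\xrightarrow[n\to\infty]{\mathbb{L}^p}2\quad\text{and}\quad\frac{\mathrm{LDS}(\sigma_n)}{\sqrt n}\xrightarrow[n\to\infty]{\mathbb{L}^p}2.$$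
   Context: $\mathfrak{S}_n$ is the group of permutations of $\{1,\dots,n\}$ and $\#(\sigma)$ is the number of cycles of $\sigma$ (fixed points included). A sequence of random permutations $(\sigma_n)_{n\ge1}$ is conjugation invariant if, for all $n\ge1$, $\sigma_n$ takes values in $\mathfrak{S}_n$ and for every $\sigma\in\mathfrak{S}_n$, $\sigma^{-1}\sigma_n\sigma$ has the same distribution as $\sigma_n$. $\mathrm{LIS}(\sigma)$ (resp. $\mathrm{LDS}(\sigma)$) is the maximal $k$ such that there are $i_1<\dots<i_k$ with $\sigma(i_1)<\dots<\sigma(i_k)$ (resp. $\sigma(i_1)>\dots>\sigma(i_k)$). *)

(* Defs.v *)
From HB Require Import structures.
From mathcomp Require Import all_boot all_order all_algebra fingroup perm.
From mathcomp Require Import all_classical all_reals all_analysis.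
Set Implicit Arguments.
Unset Strict Implicit.
Unset Printing Implicit Defensive.
Import Order.TTheory GRing.Theory Num.Theory.
Import numFieldNormedType.Exports.
Local Open Scope classical_set_scope.
Local Open Scope ring_scope.

HB.instance Definition _ (T : finType) :=
  isPointed.Build (perm_type T) (1%g : {perm T}).
HB.instance Definition _ (T : finType) :=
  @isMeasurable.Build default_measure_display (perm_type T) discrete_measurable
    discrete_measurable0 discrete_measurableC discrete_measurableU.

Definition ncycles n (s : 'S_n) : nat := #|porbits s|.

(* Subsequences i_1 < ... < i_k are strictly increasing k-tuples of indices, so
   that k <= n holds automatically and bounding k by n loses nothing. *)
Definition LIS n (s : 'S_n) : nat :=
  (\max_(k < n.+1 | [exists t : k.-tuple 'I_n,
      sorted (fun i j : 'I_n => i < j)%N t &&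
      sorted (fun i j : 'I_n => i < j)%N (map s t)]) k)%N.

Definition LDS n (s : 'S_n) : nat :=
  (\max_(k < n.+1 | [exists t : k.-tuple 'I_n,
      sorted (fun i j : 'I_n => i < j)%N t &&
      sorted (fun i j : 'I_n => i > j)%N (map s t)]) k)%N.

(* The random permutations may live on different probability spaces. The index
   n = 0 is harmless: 'S_0 is a singleton. *)
Definition conjugation_invariant (R : realType) (d : nat -> measure_display)
    (T : forall n, measurableType (d n)) (P : forall n, probability (T n) R)
    (sigma : forall n, {RV (P n) >-> 'S_n}) : Prop :=
  forall n, (0 < n)%N -> forall s : 'S_n,
    pushforward (P n) (fun w => s^-1 * sigma n w * s)%g
    = distribution (P n) (sigma n).

(* Convergence to a constant, which makes sense for variables defined on
   different probability spaces. *)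
Definition cvg_in_probability (R : realType) (d : nat -> measure_display)
    (T : forall n, measurableType (d n)) (P : forall n, probability (T n) R)
    (X : forall n, T n -> R) (c : R) : Prop :=
  forall eps : R, 0 < eps ->
    (P n [set w | eps < `|X n w - c|]) @[n --> \oo] --> 0%E.

Definition cvg_in_Lp (R : realType) (d : nat -> measure_display)
    (T : forall n, measurableType (d n)) (P : forall n, probability (T n) R)
    (p : R) (X : forall n, T n -> R) (c : R) : Prop :=
  Lnorm (P n) p%:E (fun w => (X n w - c)%:E) @[n --> \oo] --> 0%E.

(* Main.v *)
Require Import Defs.
From HB Require Import structures.
From mathcomp Require Import all_boot all_order all_algebra fingroup perm action.
From mathcomp Require Import all_classical all_reals all_analysis.
From mathcomp Require Import zify ring lra.
Set Implicit Arguments.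
Unset Strict Implicit.
Unset Printing Implicit Defensive.
Import Order.TTheory GRing.Theory Num.Theory.
Import numFieldNormedType.Exports.

(** Everything rests on the theorem of Vershik, Kerov, Logan and Shepp, that
    the LIS of a uniform permutation is close to [2 * sqrt n]. It is proved below
    by a discrete version of Hammersley's process with sources and sinks, in
    the spirit of Cator and Groeneboom, with tails exponentially small in
    [sqrt n]; the rest is a comparison of permutations that are almost equal.

    The process. A uniform permutation is compared with a random word, the LIS
    with the longest strictly increasing subsequence of the word
    ([perm_prob_le_symbol_law]). The steps of the word are letters [r < m], each
    of probability [p], sources, of probability [s], and idle steps. A state is
    a set of particles on the [m] letters; a letter [r] puts a particle at [r]
    and removes the next one above it, a source removes the lowest particle.
    Let [G] be the number of sources read plus the final number of particles.
    [G] bounds the longest increasing subsequence ([lis_le_run]), and some path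
    gains [G] by collecting sources, or initial particles, up to an exit point
    and then following an increasing subsequence of what is left ([run_exit]).
    Independent particles with odds [p / s] are invariant ([kill_mark_balance]),
    so that in equilibrium [G] is a sum of two binomial variables, of means
    [T * s] and about [m * (p / s)]. For the best [s] this gives the upper bound
    [2 * sqrt (T * m * p)] ([lis_upper_tail]).

    The lower bound. Normalise so that [T * m * p = n]; then [G] is close to
    [2 * sqrt n]. A path that leaves the boundary after a fraction [z] of it
    collects about [z * sqrt n] there, and at most about
    [2 * sqrt ((1 - z) * n)] afterwards, by the upper bound for the remaining
    rectangle. As [z + 2 * sqrt (1 - z)] is bounded away from [2] when [z] is
    bounded away from [0], the optimal path leaves the boundary almost
    immediately, and the increasing subsequence alone accounts for almost all
    of [G] ([lis_lower_tail]).

    The comparison. Changing [k] values of a permutation changes LIS and LDS by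
    at most [k] ([chain_max_lipschitz]). Merging two cycles changes two values,
    so every permutation [s] has a conjugate that differs from the standard
    n-cycle in at most [2 * #(s)] places ([near_std_cycle]). A conjugation
    invariant law is an average over conjugates, so its LIS is within
    [2 * #(s)] of the LIS of a uniform n-cycle ([law_mean_le_cycle]). Uniform
    permutations are such a law, and they have few cycles because [2 ^ #(s)] has
    mean at most [n + 1] ([sum_exp2_cycles]); this carries the concentration from
    uniform permutations to uniform n-cycles ([cycle_concentration]), and
    from there to [sigma_n]. *)

(** * Increasing subsequences of words and Hammersley's process *)

(** Idle steps leave the state alone. They make it possible to change the
    frequency of the sources while that of the letters stays the same. *)
Inductive symbol := Idle | Source | Letter of nat.

Definition is_source a := if a is Source then true else false.
Definition letters := pmap (fun a => if a is Letter r then Some r else None).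

(** The longest strictly increasing subsequence of [x] with letters at least
    [lo]: the next letter is either skipped or taken as the first term. *)
Fixpoint lis lo (x : seq nat) :=
  if x is r :: y then
    if lo <= r then maxn (lis lo y) (lis r.+1 y).+1 else lis lo y
  else 0.

(** A source enters below the state [J], a list with one entry for each letter,
    and annihilates the lowest particle. *)
Fixpoint kill J :=
  if J is b :: J' then false :: (if b then J' else kill J') else [::].

(** A letter that falls on a particle has no effect. Otherwise a particle is
    born, and the next particle above it is annihilated; in other words the
    number of particles below each height becomes what [height_mark] says. *)
Fixpoint mark r J :=
  match r, J with
  | _, [::] => [::]
  | 0, b :: J' => true :: (if b then J' else kill J')
  | r'.+1, b :: J' => b :: mark r' J'
  end.

Definition step a J :=
  match a with Idle => J | Source => kill J | Letter r => mark r J end.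

Definition run := foldl (fun J a => step a J).

Notation height l J := (count id (take l J)).

Lemma size_kill J : size (kill J) = size J.
Proof. by elim: J => //= -[] J //= ->. Qed.

Lemma size_step a J : size (step a J) = size J.
Proof.
case: a => [||r] //=; first exact: size_kill.
elim: J r => [|b J IHJ] [|r] //=; last by rewrite IHJ.
by case: b; rewrite ?size_kill.
Qed.

Lemma height_kill l J : height l (kill J) = (height l J).-1.
Proof. by elim: J l => [|[] J IHJ] [|l] //=; rewrite add0n IHJ. Qed.

Lemma height_mark r l J : r < size J ->
  height l (mark r J) =
  if l <= r then height l J else maxn (height l J) (height r J).+1.
Proof.
elim: J r l => [|b J IHJ] [|r] [|l] //= rJ.
  case: b => /=; first by rewrite maxnC; apply/esym/maxn_idPr.
  by rewrite height_kill; case: (height l J) => // k; rewrite maxnC; apply/esym/maxn_idPr.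
by rewrite IHJ // ltnS; case: ifP => // _; rewrite -addnS addn_maxr.
Qed.

Lemma leq_height l l' J : l <= l' -> height l J <= height l' J.
Proof.
by move=> ll'; rewrite -(subnKC ll') takeD count_cat leq_addr.
Qed.

Lemma lis_anti lo lo' x : lo <= lo' -> lis lo' x <= lis lo x.
Proof.
elim: x lo lo' => //= r y IHy lo lo' le_lo.
case: (leqP lo' r) => [lo'r|_]; first by rewrite (leq_trans le_lo) // geq_max !leq_max ltnS leqnn IHy // orbT.
by case: ifP => _; rewrite ?leq_max IHy.
Qed.

(** A path may start with the particles below height [l] and continue with an
    increasing subsequence of letters at least [l]; every step of the process
    keeps its length below the number of sources and particles. *)
Lemma lis_le_run l w J : all (fun r => r < size J) (letters w) ->
  height l J + lis l (letters w) <= count is_source w + count id (run J w).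
Proof.
elim: w l J => [|a w IHw] l J /=.
  by move=> _; rewrite addn0 -{2}(cat_take_drop l J) count_cat leq_addr.
case: a => [||r] /= lt_w.
- exact: IHw.
- have IH : height l (kill J) + lis l (letters w)
      <= count is_source w + count id (run (kill J) w).
    by apply: IHw; rewrite size_kill.
  rewrite add1n addSn; apply: leq_trans (_ : _ <= (_ + _).+1) _; last exact: IH.
  by rewrite height_kill -addSn leq_add2r leqSpred.
move: lt_w => /andP[rJ lt_w].
have IH l' : height l' (mark r J) + lis l' (letters w)
    <= count is_source w + count id (run (mark r J) w).
  by apply: IHw; rewrite (size_step (Letter r)).
have step1 : height l J + lis l (letters w)
    <= count is_source w + count id (run (mark r J) w).
  apply: leq_trans (IH l); rewrite leq_add2r height_mark //.
  by case: ifP => // _; rewrite leq_maxl.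
case: (leqP l r) => // lr; rewrite addn_maxr geq_max step1 /=.
apply: leq_trans (IH r.+1); rewrite addnS -addSn leq_add2r height_mark // ltnn.
by rewrite leq_max ltnS leq_height ?orbT.
Qed.

(** Undoing one step, an optimal path from the new state is turned into one from
    the old state. If the step is a letter [r] that raised the height at the exit
    point, the path now leaves the particles at [r] and takes the letter; if
    it is a source that killed nothing below the exit point, the path takes the
    source and leaves from there. *)
Lemma run_exit w J : all (fun r => r < size J) (letters w) ->
  (exists2 l, l <= size J & count is_source w + count id (run J w)
     <= height l J + lis l (letters w)) \/
  (exists2 k, k <= size w & count is_source w + count id (run J w)
     <= count is_source (take k w) + lis 0 (letters (drop k w))).
Proof.
elim: w J => [|a w IHw] J lt_w.
  by left; exists (size J); rewrite // take_size addn0.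
have {}IHw := IHw (step a J).
rewrite size_step in IHw.
have {IHw}[|[l lJ le_l]|[k kw le_k]] := IHw.
- by case: a lt_w => [||r] //= /andP[].
- case: a lt_w le_l => [||r] /= lt_w le_l.
  + by left; exists l.
  + rewrite height_kill in le_l.
    case: (posnP (height l J)) le_l => [->|h_gt0] le_l; last first.
      left; exists l => //.
      by rewrite add1n -(prednK h_gt0) !addSn ltnS.
    right; exists 1 => //=; rewrite take0 drop0 /= addn0 add1n addSn.
    by rewrite ltnS; apply: leq_trans le_l _; rewrite lis_anti.
  + case/andP: lt_w => rJ lt_w; rewrite height_mark // in le_l.
    left; case: (leqP l r) le_l => [lr|rl] le_l.
      by exists l => //; apply: leq_trans le_l _; rewrite leq_add2l /= lr leq_maxl.
    rewrite addn_maxl leq_max in le_l.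
    case/orP: le_l => le_l.
      by exists l => //=; rewrite (leqNgt l r) rl.
    exists r; first exact: ltnW.
    apply: leq_trans le_l _; rewrite /= leqnn addSnnS leq_add2l leq_max ltnS.
    by rewrite lis_anti ?orbT.
right; exists k.+1 => //=.
by rewrite -!addnA leq_add2l.
Qed.

Lemma lis_drop k lo w : lis lo (letters (drop k w)) <= lis lo (letters w).
Proof.
elim: w k => [|a w IHw] [|k] //=; apply: leq_trans (IHw k) _.
by case: a => //= r; case: ifP; rewrite // leq_max leqnn.
Qed.

Local Open Scope ring_scope.

(** * Finitely supported expectations and binomial tails *)

(** Only finitely supported laws occur, and they are handled as functionals.
    [S] is a set of full measure. *)
Record expectation (R : realType) A (S : pred A) (E : (A -> R) -> R) := {
  mean_le : forall F G, (forall a, S a -> F a <= G a) -> E F <= E G;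
  mean_lin : forall c F G, E (fun a => c * F a + G a) = c * E F + E G;
  mean_cst1 : E (fun=> 1) = 1 }.

Lemma mean_eq (R : realType) A (S : pred A) (E : (A -> R) -> R) F G :
  expectation S E -> (forall a, S a -> F a = G a) -> E F = E G.
Proof.
move=> eE FG; apply/le_anti/andP; split; apply: (mean_le eE) => a Sa;
by rewrite FG.
Qed.

Lemma meanZ (R : realType) A (S : pred A) (E : (A -> R) -> R) c F :
  expectation S E -> E (fun a => c * F a) = c * E F.
Proof.
move=> eE; have := mean_lin eE (-1) F F.
rewrite mulN1r addNr => E0; rewrite -[RHS]addr0 -E0 -(mean_lin eE).
by apply: (mean_eq eE) => a _; rewrite mulN1r addNr addr0.
Qed.

Lemma meanD (R : realType) A (S : pred A) (E : (A -> R) -> R) F G :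
  expectation S E -> E (fun a => F a + G a) = E F + E G.
Proof.
move=> eE; rewrite -[E F]mul1r -(mean_lin eE).
by apply: (mean_eq eE) => a _; rewrite mul1r.
Qed.

Lemma mean_cst (R : realType) A (S : pred A) (E : (A -> R) -> R) c :
  expectation S E -> E (fun=> c) = c.
Proof.
move=> eE; rewrite -[RHS]mulr1 -(mean_cst1 eE) -(meanZ _ _ eE).
by apply: (mean_eq eE) => a _; rewrite mulr1.
Qed.

Lemma mean_sum (R : realType) A (S : pred A) (E : (A -> R) -> R) I (r : seq I) F :
  expectation S E -> E (fun a => \sum_(i <- r) F i a) = \sum_(i <- r) E (F i).
Proof.
move=> eE; elim: r => [|i r IHr].
  by rewrite big_nil -[RHS](mean_cst 0 eE); apply: (mean_eq eE) => a _; rewrite big_nil.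
rewrite big_cons -IHr -(meanD _ _ eE).
by apply: (mean_eq eE) => a _; rewrite big_cons.
Qed.

Definition prob (R : realType) A (E : (A -> R) -> R) (P : A -> bool) : R :=
  E (fun a => (P a)%:R).

Lemma prob_ge0 (R : realType) A (S : pred A) (E : (A -> R) -> R)
    (P : A -> bool) :
  expectation S E -> 0 <= prob E P.
Proof.
by move=> eE; rewrite -(mean_cst 0 eE); apply: (mean_le eE) => a _; exact: ler0n.
Qed.

Lemma prob_le1 (R : realType) A (S : pred A) (E : (A -> R) -> R)
    (P : A -> bool) :
  expectation S E -> prob E P <= 1.
Proof.
by move=> eE; rewrite -(mean_cst1 eE); apply: (mean_le eE) => a _; case: (P a).
Qed.

Lemma prob_sub (R : realType) A (S : pred A) (E : (A -> R) -> R)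
    (P Q : A -> bool) :
  expectation S E -> (forall a, S a -> P a -> Q a) -> prob E P <= prob E Q.
Proof.
move=> eE PQ; apply: (mean_le eE) => a Sa.
by case: (P a) (PQ a Sa) => [->|_] //; exact: ler0n.
Qed.

Lemma prob_or (R : realType) A (S : pred A) (E : (A -> R) -> R)
    (P Q : A -> bool) :
  expectation S E -> prob E (fun a => P a || Q a) <= prob E P + prob E Q.
Proof.
move=> eE; rewrite /prob -(meanD _ _ eE); apply: (mean_le eE) => a _.
by rewrite -natrD ler_nat; case: (P a).
Qed.

Lemma prob_has (R : realType) A (S : pred A) (E : (A -> R) -> R) K
    (P : nat -> A -> bool) q :
  expectation S E -> (forall k, (k < K)%N -> prob E (P k) <= q) ->
  prob E (fun a => has (P^~ a) (iota 0 K)) <= K%:R * q.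
Proof.
move=> eE; elim: K => [|K IHK] Pq.
  by rewrite mul0r -[leRHS](mean_cst 0 eE); apply: (mean_le eE).
rewrite -addn1 natrD mulrDl mul1r.
apply: le_trans (lerD (IHK (fun k kK => Pq k (ltnW kK))) (Pq K (ltnSn K))).
apply: le_trans (prob_or _ _ eE); apply: (prob_sub eE) => a _.
by rewrite iotaD has_cat /= orbF.
Qed.

Definition joint_mean (R : realType) A B (E : (A -> R) -> R)
    (E' : (B -> R) -> R) (F : A * B -> R) : R :=
  E (fun a => E' (fun b => F (a, b))).

Lemma joint_expectation (R : realType) A B SA SB (E : (A -> R) -> R)
    (E' : (B -> R) -> R) :
  expectation SA E -> expectation SB E' ->
  expectation (fun x => SA x.1 && SB x.2) (joint_mean E E').
Proof.
move=> eE eE'; split.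
- move=> F G FG; apply: (mean_le eE) => a Sa; apply: (mean_le eE') => b Sb.
  by apply: FG; rewrite Sa.
- move=> c F G; rewrite -(mean_lin eE); apply: (mean_eq eE) => a _.
  by rewrite -(mean_lin eE').
- rewrite -[RHS](mean_cst1 eE); apply: (mean_eq eE) => a _.
  exact: mean_cst1 eE'.
Qed.

Lemma prob_joint1 (R : realType) A B SA SB (E : (A -> R) -> R)
    (E' : (B -> R) -> R) P :
  expectation SA E -> expectation SB E' ->
  prob (joint_mean E E') (fun x => P x.1) = prob E P.
Proof.
by move=> eE eE'; apply: (mean_eq eE) => a _; rewrite /= (mean_cst _ eE').
Qed.

Lemma prob_joint2 (R : realType) A B SA (E : (A -> R) -> R)
    (E' : (B -> R) -> R) P :
  expectation SA E -> prob (joint_mean E E') (fun x => P x.2) = prob E' P.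
Proof. by move=> eE; exact: (mean_cst (E' (fun b => (P b)%:R)) eE). Qed.

(** The product measure, integrated one coordinate at a time; this suits words
    that are read from the left. *)
Fixpoint iid (R : realType) A (E : (A -> R) -> R) T (F : seq A -> R) : R :=
  if T is T'.+1 then E (fun a => iid E T' (fun w => F (a :: w))) else F [::].

Definition words A T (S : pred A) : pred (seq A) :=
  fun w => (size w == T) && all S w.

Lemma iid_expectation (R : realType) A S (E : (A -> R) -> R) T :
  expectation S E -> expectation (words T S) (iid E T).
Proof.
move=> eE; elim: T => [|T IHT]; split => /=.
- by move=> F G; exact.
- by [].
- by [].
- move=> F G FG; apply: (mean_le eE) => a Sa; apply: (mean_le IHT) => w /andP[sw Sw].
  by apply: FG; rewrite /words /= eqSS sw Sa.
- move=> c F G; rewrite -(mean_lin eE); apply: (mean_eq eE) => a _.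
  by rewrite -(mean_lin IHT).
- rewrite -[RHS](mean_cst1 eE); apply: (mean_eq eE) => a _.
  exact: (mean_cst1 IHT).
Qed.

Lemma iid_take (R : realType) A S (E : (A -> R) -> R) T k F :
  expectation S E -> (k <= T)%N ->
  iid E T (fun w => F (take k w)) = iid E k F.
Proof.
move=> eE; elim: k T F => [|k IHk] T F kT /=.
  rewrite -[RHS](mean_cst _ (iid_expectation T eE)).
  by apply: (mean_eq (iid_expectation T eE)) => w _; rewrite take0.
case: T kT => // T kT /=; apply: (mean_eq eE) => a _.
by rewrite -(IHk T).
Qed.

Lemma iid_drop (R : realType) A S (E : (A -> R) -> R) T k F :
  expectation S E -> (k <= T)%N ->
  iid E T (fun w => F (drop k w)) = iid E (T - k) F.
Proof.
move=> eE; elim: k T F => [|k IHk] T F kT /=.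
  by rewrite subn0; apply: (mean_eq (iid_expectation T eE)) => w _; rewrite drop0.
case: T kT => // T kT; rewrite subSS -(IHk T) //=.
by rewrite -[RHS](mean_cst _ eE).
Qed.

Lemma prob_take (R : realType) A S (E : (A -> R) -> R) T k P :
  expectation S E -> (k <= T)%N ->
  prob (iid E T) (fun w => P (take k w)) = prob (iid E k) P.
Proof. exact: (iid_take (fun w => (P w)%:R)). Qed.

Lemma prob_drop (R : realType) A S (E : (A -> R) -> R) T k P :
  expectation S E -> (k <= T)%N ->
  prob (iid E T) (fun w => P (drop k w)) = prob (iid E (T - k)) P.
Proof. exact: (iid_drop (fun w => (P w)%:R)). Qed.

(** Words with an image alphabet: it is enough to push the law of one symbol
    forward. *)
Lemma iid_map (R : realType) A B SA SB (E : (A -> R) -> R) (E' : (B -> R) -> R)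
    (h : A -> B) T F :
  expectation SA E -> expectation SB E' ->
  (forall G, E (fun a => G (h a)) = E' G) ->
  iid E T (fun w => F (map h w)) = iid E' T F.
Proof.
move=> eE eE' hE; elim: T F => [|T IHT] F //=; rewrite -hE.
by apply: (mean_eq eE) => a _; rewrite -IHT.
Qed.

Lemma iid_expR_count (R : realType) A S (E : (A -> R) -> R) T (P : pred A) t :
  expectation S E ->
  iid E T (fun w => expR (t * (count P w)%:R)) =
  (1 + prob E P * (expR t - 1)) ^+ T.
Proof.
move=> eE; elim: T => [|T IHT] /=; first by rewrite mulr0 expR0 expr0.
rewrite exprS -IHT mulrC -[X in _ = _ * X]addrC -(mean_cst1 eE) mulrC.
rewrite [prob _ _ * (_ - _)]mulrC -(mean_lin eE) mulrC -(meanZ _ _ eE).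
apply: (mean_eq eE) => a _; rewrite mulrC -(meanZ _ _ (iid_expectation T eE)).
apply: (mean_eq (iid_expectation T eE)) => w _.
rewrite (mean_cst1 eE) natrD mulrDr expRD; congr (_ * _).
by case: (P a); rewrite /= ?mulr1 ?mulr0 ?mul0r ?expR0 ?add0r // subrK.
Qed.

(** From [1 - t <= expR (- t)], hence [expR t <= (1 - t)^-1]. *)
Lemma expR_quad (R : realType) (t : R) : `|t| <= 1 / 2 ->
  expR t <= 1 + (t + 2 * t ^+ 2).
Proof.
rewrite ler_norml => /andP[t1 t2].
have : expR t <= (1 - t)^-1.
  rewrite -[t in expR t]opprK expRN lef_pV2 ?posrE ?expR_gt0 //; last lra.
  by have := expR_ge1Dx (- t).
move=> /le_trans; apply; rewrite -[X in X <= _]mul1r ler_pdivrMr; last lra.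
have : 0 <= t ^+ 2 by exact: sqr_ge0.
have : 0 <= t ^+ 2 * (1 - 2 * t) by rewrite mulr_ge0 ?sqr_ge0 //; lra.
nra.
Qed.

(** The Laplace transform of a binomial variable is at most that of a Poisson
    variable of the same mean, to which [expR_quad] applies. *)
Lemma iid_expR_count_le (R : realType) A S (E : (A -> R) -> R) T (P : pred A) t :
  expectation S E -> `|t| <= 1 / 2 ->
  iid E T (fun w => expR (t * (count P w)%:R)) <=
  expR (T%:R * prob E P * (t + 2 * t ^+ 2)).
Proof.
move=> eE t2; rewrite (iid_expR_count _ _ _ eE) -mulrA expRM_natl.
have q0 := prob_ge0 P eE; have q1 := prob_le1 P eE.
set q := prob E P in q0 q1 *.
have et := expR_gt0 t.
rewrite lerXn2r // ?nnegrE ?expR_ge0 //; first by nra.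
apply: le_trans (expR_ge1Dx _); rewrite lerD2l ler_wpM2l //.
by have := expR_quad t2; lra.
Qed.

(** Chernoff's bound with parameter [d / 8]. The scale [N] of the deviation is
    separate from the mean, because several binomials with means between [0] and
    [2 * N] are compared at the same scale. *)
Lemma count_upper_tail (R : realType) A S (E : (A -> R) -> R) T (P : pred A)
    (M N d : R) :
  expectation S E -> 0 <= d <= 1 -> 0 <= N -> M <= 2 * N ->
  T%:R * prob E P <= M ->
  prob (iid E T) (fun w => M + d * N <= (count P w)%:R) <= expR (- (d ^+ 2 * N / 16)).
Proof.
move=> eE /andP[d0 d1] N0 MN TM.
set x := M + d * N; set t := d / 8.
have t0 : 0 <= t by rewrite /t; lra.
have t2 : `|t| <= 1 / 2 by rewrite ger0_norm // /t; lra.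
apply: le_trans (_ : expR (- (t * x)) *
    expR (T%:R * prob E P * (t + 2 * t ^+ 2)) <= _); last first.
  rewrite -expRD ler_expR /x.
  have : T%:R * prob E P * (t + 2 * t ^+ 2) <= M * (t + 2 * t ^+ 2).
    by apply: ler_wpM2r => //; rewrite addr_ge0 // mulr_ge0 ?sqr_ge0.
  have : M * t ^+ 2 <= 2 * N * t ^+ 2 by apply: ler_wpM2r => //; exact: sqr_ge0.
  rewrite /t; lra.
apply: le_trans (_ : expR (- (t * x)) * iid E T (fun w => expR (t * (count P w)%:R)) <= _); last first.
  by rewrite ler_wpM2l ?expR_ge0 // (iid_expR_count_le _ _ eE).
rewrite -(meanZ _ _ (iid_expectation T eE)); apply: (mean_le (iid_expectation T eE)) => w _.
case: (leP x) => [xw|_] /=; last by rewrite mulr_ge0 ?expR_ge0.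
by rewrite -expRD -[leLHS]expR0 ler_expR; nra.
Qed.

Lemma count_lower_tail (R : realType) A S (E : (A -> R) -> R) T (P : pred A)
    (M N d : R) :
  expectation S E -> 0 <= d <= 1 -> 0 <= N ->
  M <= T%:R * prob E P -> T%:R * prob E P <= 2 * N ->
  prob (iid E T) (fun w => (count P w)%:R <= M - d * N) <= expR (- (d ^+ 2 * N / 16)).
Proof.
move=> eE /andP[d0 d1] N0 MT TN.
set x := M - d * N; set t := d / 8.
have t0 : 0 <= t by rewrite /t; lra.
have t2 : `|- t| <= 1 / 2 by rewrite normrN ger0_norm // /t; lra.
have := iid_expR_count_le T P eE t2.
set q := T%:R * _ in MT TN *.
move=> le_q; apply: le_trans (_ : expR (t * x) *
    expR (q * (- t + 2 * (- t) ^+ 2)) <= _); last first.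
  rewrite -expRD ler_expR /x sqrrN.
  have : q * t ^+ 2 <= 2 * N * t ^+ 2 by apply: ler_wpM2r => //; exact: sqr_ge0.
  have : M * t <= q * t by apply: ler_wpM2r.
  rewrite /t; lra.
apply: le_trans (_ : expR (t * x) * iid E T (fun w => expR (- t * (count P w)%:R)) <= _); last first.
  by rewrite ler_wpM2l ?expR_ge0.
rewrite -(meanZ _ _ (iid_expectation T eE)); apply: (mean_le (iid_expectation T eE)) => w _.
case: (leP _ x) => [xw|_] /=; last by rewrite mulr_ge0 ?expR_ge0.
by rewrite -expRD -[leLHS]expR0 ler_expR; nra.
Qed.

(** * The invariant measure of the process and the upper tail *)

Definition bernoulli_mean (R : realType) (b : R) (F : bool -> R) : R :=
  (1 - b) * F false + b * F true.

Definition symbol_mean (R : realType) (s p : R) m (F : symbol -> R) : R :=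
  (1 - s - m%:R * p) * F Idle + s * F Source +
  p * \sum_(0 <= r < m) F (Letter r).

Definition letter_below m : pred symbol :=
  fun a => if a is Letter r then (r < m)%N else true.

Lemma bernoulli_expectation (R : realType) (b : R) : 0 <= b <= 1 ->
  expectation predT (bernoulli_mean b).
Proof.
move=> /andP[b0 b1]; split; rewrite /bernoulli_mean.
- by move=> F G FG; rewrite lerD // ler_wpM2l ?subr_ge0 // FG.
- by move=> c F G; ring.
- by ring.
Qed.

Lemma symbol_expectation (R : realType) (s p : R) m :
  0 <= s -> 0 <= p -> s + m%:R * p <= 1 ->
  expectation (letter_below m) (symbol_mean s p m).
Proof.
move=> s0 p0 sp1; split; rewrite /symbol_mean.
- move=> F G FG; rewrite lerD // ?lerD // ?ler_wpM2l ?FG //; first lra.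
  by apply: ler_sum_nat => r /andP[_ rm]; apply: FG.
- move=> c F G; rewrite big_split /= -mulr_sumr; ring.
- by rewrite sumr_const_nat subn0 -[1 *+ m]/(m%:R); ring.
Qed.

Lemma symbol_meanC (R : realType) B (S : pred B) (E : (B -> R) -> R) s p m F :
  expectation S E ->
  E (fun b => symbol_mean s p m (fun a => F a b)) =
  symbol_mean s p m (fun a => E (F a)).
Proof.
move=> eE; rewrite /symbol_mean (meanD _ _ eE) (meanD _ _ eE).
by rewrite !(meanZ _ _ eE) (mean_sum _ _ eE).
Qed.

(** Burke's property. The balance holds letter by letter: by induction on
    [m], the flow through the upper letters is balanced for either state of the
    lowest letter, and [s * b = p * (1 - b)] settles the lowest letter, where a
    source or a mark either stops or is passed on upwards as a source. *)
Lemma kill_mark_balance (R : realType) (s p b : R) m F :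
  s * b = p * (1 - b) -> 0 <= b <= 1 ->
  s * iid (bernoulli_mean b) m (fun J => F (kill J)) +
  p * \sum_(0 <= r < m) iid (bernoulli_mean b) m (fun J => F (mark r J)) =
  (s + m%:R * p) * iid (bernoulli_mean b) m F.
Proof.
move=> sb b01; elim: m F => [|m IHm] F /=.
  by rewrite big_nil mulr0 mul0r !addr0.
rewrite /bernoulli_mean /= big_nat_recl //= big_split /= -!mulr_sumr.
have := IHm (fun J => F (false :: J)).
have := IHm (fun J => F (true :: J)).
set k0 := iid _ m (fun J => F (false :: kill J)).
set k1 := iid _ m (fun J => F (true :: kill J)).
set e0 := iid _ m (fun J => F (false :: J)).
set e1 := iid _ m (fun J => F (true :: J)).
set s1 := \sum_(_ <= _ < _) _; set s0 := \sum_(_ <= _ < _) _.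
move=> H1 H0; rewrite -natr1.
transitivity ((1 - b) * (s * k0 + p * s0) + b * (p * s1) + (p * (1 - b)) * k1
  + (s * b) * e0 + p * b * e1); first ring.
rewrite -sb H0.
transitivity ((1 - b) * ((s + m%:R * p) * e0) + b * (s * k1 + p * s1)
   + s * b * e0 + p * b * e1); first ring.
by rewrite H1 sb; ring.
Qed.

Lemma run_invariant (R : realType) (s p b : R) m T F :
  0 <= s -> 0 <= p -> s + m%:R * p <= 1 ->
  s * b = p * (1 - b) -> 0 <= b <= 1 ->
  iid (symbol_mean s p m) T
    (fun w => iid (bernoulli_mean b) m (fun J => F (run J w))) =
  iid (bernoulli_mean b) m F.
Proof.
move=> s0 p0 sp1 sb b01; have eS := symbol_expectation s0 p0 sp1.
have eB := iid_expectation m (bernoulli_expectation b01).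
elim: T F => [//|T IHT] F /=.
rewrite -(symbol_meanC _ _ _ _ (iid_expectation T eS)) /=.
rewrite -[RHS]IHT; apply: (mean_eq (iid_expectation T eS)) => w _.
have := kill_mark_balance m (fun J => F (run J w)) sb b01.
by rewrite /symbol_mean /= => H; rewrite -addrA H; ring.
Qed.

Lemma prob_run (R : realType) (s p b : R) m T P :
  0 <= s -> 0 <= p -> s + m%:R * p <= 1 ->
  s * b = p * (1 - b) -> 0 <= b <= 1 ->
  prob (joint_mean (iid (symbol_mean s p m) T) (iid (bernoulli_mean b) m))
    (fun x => P (run x.2 x.1)) =
  prob (iid (bernoulli_mean b) m) P.
Proof. exact: (run_invariant T (fun J => (P J)%:R)). Qed.

(** Keeps the letters at least [l], renumbered from [0], and turns everything
    else into idle steps. *)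
Definition drop_letters l a :=
  if a is Letter r then (if (r < l)%N then Idle else Letter (r - l)) else Idle.

Lemma lis_drop_letters l w :
  lis 0 (letters (map (drop_letters l) w)) = lis l (letters w).
Proof.
suff H lo : lis lo (letters (map (drop_letters l) w)) = lis (l + lo) (letters w).
  by rewrite H addn0.
elim: w lo => //= -[||r] w IHw lo //=.
case: (ltnP r l) => rl /=; first by rewrite IHw [in RHS]leqNgt (leq_trans rl) ?leq_addr.
by rewrite !IHw leq_subRL // addnS subnKC.
Qed.

Lemma symbol_mean_drop_letters (R : realType) (s p : R) m l F : (l <= m)%N ->
  symbol_mean s p m (fun a => F (drop_letters l a)) =
  symbol_mean 0 p (m - l) F.
Proof.
move=> lm; rewrite /symbol_mean /= (big_cat_nat (n := l)) //=.
rewrite (eq_big_nat _ _ (F2 := fun=> F Idle)) => [|r /andP[_ ->] //].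
rewrite sumr_const_nat subn0 -{2}[l]add0n big_addn.
rewrite (eq_bigr (fun r => F (Letter r))) => [|r _]; last first.
  by rewrite ltnNge leq_addl addnK.
rewrite natrB // -mulr_natl; ring.
Qed.

(** The sources do not enter the increasing subsequences, so their frequency may
    be chosen at will; restricting to letters at least [l] only shortens the
    alphabet. Both sides are the law with no sources at all. *)
Lemma prob_lis_indep_source (R : realType) (s s' p : R) m l T P :
  0 <= s -> 0 <= s' -> 0 <= p -> s + m%:R * p <= 1 ->
  s' + (m - l)%:R * p <= 1 -> (l <= m)%N ->
  prob (iid (symbol_mean s p m) T) (fun w => P (lis l (letters w))) =
  prob (iid (symbol_mean s' p (m - l)) T) (fun w => P (lis 0 (letters w))).
Proof.
move=> s0 s'0 p0 sp1 s'p1 lm.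
have e0 : expectation (letter_below (m - l)) (symbol_mean 0 p (m - l)).
  by apply: symbol_expectation => //; lra.
have eS := symbol_expectation s0 p0 sp1.
have eS' := symbol_expectation s'0 p0 s'p1.
transitivity (prob (iid (symbol_mean 0 p (m - l)) T)
    (fun w => P (lis 0 (letters w)))).
  rewrite /prob -(iid_map (E := symbol_mean s p m) (h := drop_letters l) _ _ eS e0).
    by apply: (mean_eq (iid_expectation T eS)) => w _; rewrite lis_drop_letters.
  by move=> G; apply: symbol_mean_drop_letters.
rewrite /prob -(iid_map (E := symbol_mean s' p (m - l)) (h := drop_letters 0) _ _ eS' e0).
  by apply: (mean_eq (iid_expectation T eS')) => w _; rewrite lis_drop_letters.
by move=> G; rewrite symbol_mean_drop_letters // subn0.
Qed.

Lemma letters_below m T w : words T (letter_below m) w ->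
  all (fun r => r < m)%N (letters w).
Proof. by case/andP => _; elim: w => //= -[||r] w IHw //= /andP[-> /IHw]. Qed.

Lemma prob_source (R : realType) (s p : R) m :
  prob (symbol_mean s p m) is_source = s.
Proof.
by rewrite /prob /symbol_mean /= big1 ?mulr0 ?addr0 // add0r mulr1.
Qed.

Lemma prob_true (R : realType) (b : R) : prob (bernoulli_mean b) id = b.
Proof. by rewrite /prob /bernoulli_mean mulr0 add0r mulr1. Qed.

(** The density of particles whose odds are [p / s]. *)
Definition sink_prob (R : realType) (s p : R) := p / (s + p).

Lemma sink_prob_bounds (R : realType) (s p : R) : 0 < s -> 0 <= p ->
  0 <= sink_prob s p <= 1.
Proof.
move=> s0 p0; rewrite /sink_prob divr_ge0 ?ler_pdivrMr /= ?mul1r; lra.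
Qed.

Lemma sink_prob_le (R : realType) (s p : R) : 0 < s -> 0 <= p ->
  sink_prob s p <= p / s.
Proof. by move=> s0 p0; rewrite ler_wpM2l // lef_pV2 ?posrE //; lra. Qed.

Lemma sink_prob_balance (R : realType) (s p : R) : 0 < s -> 0 <= p ->
  s * sink_prob s p = p * (1 - sink_prob s p).
Proof. by move=> s0 p0; rewrite /sink_prob; field; lra. Qed.

(** Start the process in equilibrium. A union bound over the two binomial parts
    of its total avoids their joint law. *)
Lemma lis_upper_tail (R : realType) (s p N d : R) m T :
  0 < s -> 0 <= p -> s + m%:R * p <= 1 -> 0 <= d <= 1 -> 0 <= N ->
  forall A B, A <= 2 * N -> B <= 2 * N -> T%:R * s <= A -> m%:R * (p / s) <= B ->
  prob (iid (symbol_mean s p m) T)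
    (fun w => A + B + 2 * (d * N) <= (lis 0 (letters w))%:R) <=
  2 * expR (- (d ^+ 2 * N / 16)).
Proof.
move=> s0 p0 sp1 d01 N0 A B AN BN TA mB.
have eS := symbol_expectation (ltW s0) p0 sp1.
have eW := iid_expectation T eS.
have b01 := sink_prob_bounds s0 p0; set b := sink_prob s p in b01.
have eb := bernoulli_expectation b01.
have eB := iid_expectation m eb.
have sb := sink_prob_balance s0 p0.
have Bb : m%:R * prob (bernoulli_mean b) id <= B.
  rewrite prob_true; apply: le_trans mB; rewrite ler_wpM2l //.
  exact: sink_prob_le.
pose E := joint_mean (iid (symbol_mean s p m) T) (iid (bernoulli_mean b) m).
have eE : expectation _ E := joint_expectation eW eB.
have h1 : prob E (fun x => A + d * N <= (count is_source x.1)%:R) <=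
    expR (- (d ^+ 2 * N / 16)).
  rewrite (prob_joint1 (fun w => A + d * N <= (count is_source w)%:R) eW eB).
  by apply: (count_upper_tail eS d01 N0 AN); rewrite prob_source.
have h2 : prob E (fun x => B + d * N <= (count id (run x.2 x.1))%:R) <=
    expR (- (d ^+ 2 * N / 16)).
  rewrite (prob_run T (fun J => B + d * N <= (count id J)%:R) (ltW s0)) //.
  exact: (count_upper_tail eb d01 N0 BN Bb).
rewrite [leRHS]mulr_natl mulr2n; apply: le_trans (lerD h1 h2).
apply: le_trans (prob_or _ _ eE).
rewrite -(prob_joint1 (fun w => A + B + 2 * (d * N) <= (lis 0 (letters w))%:R) eW eB).
apply: (prob_sub eE) => -[w J] /= /andP[ww /andP[/eqP sJ _]].
move=> le_lis; have := @lis_le_run 0 w J.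
rewrite take0 add0n sJ => /(_ (letters_below ww)).
rewrite -(ler_nat R) natrD => le_run.
by apply/orP; case: (leP (A + d * N) _) => H; [left|right; lra].
Qed.

(** * The lower tail: optimal paths leave the boundary near the origin *)

(** An upper bound for [2 * sqrt (1 - z)], which is what a path gains after
    leaving the boundary at the fraction [z]. It comes from the source rate
    multiplied by [1 - z / 2], or divided by it, instead of the optimal
    [sqrt (1 - z)], and avoids square roots. *)
Definition exit_cost (R : realType) (z : R) := (1 - z) / (1 - z / 2) + (1 - z / 2).

Lemma exit_cost_gap (R : realType) (z : R) : 0 <= z <= 1 ->
  z + exit_cost z <= 2 - z ^+ 2 / 4.
Proof.
move=> /andP[z0 z1]; rewrite /exit_cost.
have r0 : 0 < 1 - z / 2 by lra.
have -> : z + ((1 - z) / (1 - z / 2) + (1 - z / 2)) =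
    2 - z ^+ 2 / 4 * (1 - z / 2)^-1 by field; lra.
rewrite lerD2l lerN2 ler_peMr ?divr_ge0 ?sqr_ge0 ?ler0n //.
by rewrite invf_ge1 //; lra.
Qed.

(** With [2 * N ^+ 2] steps and letters of total probability [1 / 2], this rate
    gives about [N] sources and [N] particles. *)
Definition source_rate (R : realType) (N : R) : R := (2 * N)^-1.

Definition letter_rate (R : realType) m : R := (2 * m%:R)^-1.

Definition symbol_law (R : realType) (N : R) m :=
  symbol_mean (source_rate N) (letter_rate R m) m.

Definition sink_law (R : realType) (N : R) m :=
  bernoulli_mean (sink_prob (source_rate N) (letter_rate R m)).

(** [N] is the square root of the mean number of letters read, [d] the precision
    on the scale of [N]. *)
Record regime (R : realType) (N d : R) m T : Prop := Regime {
  regime_N : 2 <= N; regime_d : 0 < d; regime_d1 : d <= 1; regime_m : (0 < m)%N;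
  regime_T : T%:R = 2 * N ^+ 2; regime_Nm : N <= d * m%:R }.

Lemma regime_rates (R : realType) (N d : R) m T : regime N d m T ->
  [/\ 0 < source_rate N <= 1 / 4, 0 <= letter_rate R m,
      m%:R * letter_rate R m = 1 / 2, T%:R * source_rate N = N &
      m%:R * (letter_rate R m / source_rate N) = N].
Proof.
case=> N2 d0 d1 m0 TN Nm; rewrite /source_rate /letter_rate.
have mp : m%:R * (2 * m%:R)^-1 = 1 / 2 :> R by field; rewrite pnatr_eq0 -lt0n.
split=> //.
- by rewrite invr_gt0; apply/andP; split; [lra|rewrite -[leLHS]mul1r ler_pdivrMr; lra].
- by rewrite TN; field; lra.
- by rewrite mulrA mp invrK; lra.
Qed.

Lemma symbol_law_expectation (R : realType) (N d : R) m T : regime N d m T ->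
  expectation (letter_below m) (symbol_law N m).
Proof.
move=> /regime_rates[/andP[s0 s1] p0 mp _ _].
by apply: symbol_expectation => //; rewrite ?mp; lra.
Qed.

Lemma sink_law_expectation (R : realType) (N d : R) m T : regime N d m T ->
  expectation predT (sink_law N m).
Proof.
move=> /regime_rates[/andP[s0 s1] p0 mp _ _].
exact/bernoulli_expectation/sink_prob_bounds.
Qed.

Lemma source_exit_tail (R : realType) (N d z : R) m T k :
  regime N d m T -> (k <= T)%N -> z = k%:R / T%:R ->
  prob (iid (symbol_law N m) T)
    (fun w => (z + d) * N <= (count is_source (take k w))%:R) <=
  expR (- (d ^+ 2 * N / 16)).
Proof.
move=> reg; have [N2 d0 d1 m0 TN Nm] := reg.
have [/andP[s0 s1] p0 mp Ts mps] := regime_rates reg.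
have d01 : 0 <= d <= 1 by rewrite ltW.
set s := source_rate N in s0 s1 Ts mps; set p := letter_rate R m in p0 mp mps.
have eS := symbol_law_expectation reg.
move=> kT zE;
rewrite (prob_take (fun w => (z + d) * N <= (count is_source w)%:R) eS kT) mulrDl.
have T0 : 0 < T%:R :> R by rewrite TN; nra.
have z1 : z <= 1 by rewrite zE ler_pdivrMr // mul1r ler_nat.
apply: (count_upper_tail eS) => //; [lra|nra|].
by rewrite prob_source -{1}[k%:R](divfK (lt0r_neq0 T0)) -zE -mulrA Ts.
Qed.

(** The steps after time [k] are compared with an equilibrium whose source rate
    is tuned to the shorter time. *)
Lemma lis_drop_tail (R : realType) (N d z : R) m T k :
  regime N d m T -> (k <= T)%N -> z = k%:R / T%:R ->
  prob (iid (symbol_law N m) T)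
    (fun w => (exit_cost z + 2 * d) * N <= (lis 0 (letters (drop k w)))%:R) <=
  2 * expR (- (d ^+ 2 * N / 16)).
Proof.
move=> reg; have [N2 d0 d1 m0 TN Nm] := reg.
have [/andP[s0 s1] p0 mp Ts mps] := regime_rates reg.
have d01 : 0 <= d <= 1 by rewrite ltW.
set s := source_rate N in s0 s1 Ts mps; set p := letter_rate R m in p0 mp mps.
have eS := symbol_law_expectation reg.
move=> kT zE;
rewrite (prob_drop (fun w => (exit_cost z + 2 * d) * N <= (lis 0 (letters w))%:R) eS kT).
have T0 : 0 < T%:R :> R by rewrite TN; nra.
have z1 : z <= 1 by rewrite zE ler_pdivrMr // mul1r ler_nat.
have z0 : 0 <= z by rewrite zE divr_ge0 ?ler0n.
have r0 : 1 / 2 <= 1 - z / 2 by lra.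
have rI : (1 - z / 2)^-1 <= 2 by rewrite -[leRHS]invrK lef_pV2 ?posrE; lra.
have rI0 : 0 < (1 - z / 2)^-1 by rewrite invr_gt0; lra.
have s'0 : 0 < s * (1 - z / 2)^-1 by rewrite mulr_gt0.
have s'1 : s * (1 - z / 2)^-1 + m%:R * p <= 1 by rewrite mp; nra.
have E := @prob_lis_indep_source _ s (s * (1 - z / 2)^-1) p m 0 (T - k)
  (fun x => (exit_cost z + 2 * d) * N <= x%:R).
rewrite ?subn0 in E; rewrite [leLHS]E //; try exact: ltW; last by rewrite mp; lra.
rewrite /exit_cost 2!mulrDl -[2 * d * N]mulrA.
apply: (lis_upper_tail s'0) => //; first lra.
- rewrite ler_wpM2r //; first lra.
  by rewrite ler_pdivrMr; lra.
- by rewrite ler_wpM2r; lra.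
- have kE : k%:R = z * T%:R by rewrite zE divfK ?lt0r_neq0.
  rewrite natrB // kE -[N in leRHS]Ts.
  by rewrite le_eqVlt; apply/orP; left; apply/eqP; field; lra.
- rewrite mulrA mp invfM invrK mulrA /s invrK.
  by rewrite le_eqVlt; apply/orP; left; apply/eqP; lra.
Qed.

(** The letters at least [l] are compared with an equilibrium whose source rate
    is tuned to the shorter alphabet. *)
Lemma lis_letters_tail (R : realType) (N d z : R) m T l :
  regime N d m T -> (l <= m)%N -> z = l%:R / m%:R ->
  prob (iid (symbol_law N m) T)
    (fun w => (exit_cost z + 2 * d) * N <= (lis l (letters w))%:R) <=
  2 * expR (- (d ^+ 2 * N / 16)).
Proof.
move=> reg; have [N2 d0 d1 m0 TN Nm] := reg.
have [/andP[s0 s1] p0 mp Ts mps] := regime_rates reg.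
have d01 : 0 <= d <= 1 by rewrite ltW.
set s := source_rate N in s0 s1 Ts mps; set p := letter_rate R m in p0 mp mps.
have eS := symbol_law_expectation reg.
move=> lm zE.
have M0 : 0 < m%:R :> R by rewrite ltr0n.
have z1 : z <= 1 by rewrite zE ler_pdivrMr // mul1r ler_nat.
have z0 : 0 <= z by rewrite zE divr_ge0 ?ler0n.
have r0 : 1 / 2 <= 1 - z / 2 by lra.
have s'0 : 0 < s * (1 - z / 2) by rewrite mulr_gt0 //; lra.
have mlp : (m - l)%:R * p = (1 - z) / 2.
  rewrite natrB // mulrBl mp -{1}[l%:R](divfK (lt0r_neq0 M0)) -zE -mulrA mp; lra.
have s'1 : s * (1 - z / 2) + (m - l)%:R * p <= 1 by rewrite mlp; nra.
have E := @prob_lis_indep_source _ s (s * (1 - z / 2)) p m l T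
  (fun x => (exit_cost z + 2 * d) * N <= x%:R).
rewrite ?subn0 in E; rewrite [leLHS]E //; try exact: ltW; last by rewrite mp; lra.
rewrite /exit_cost 2!mulrDl -[2 * d * N]mulrA [(1 - z) / _ * N + _]addrC.
apply: (lis_upper_tail s'0) => //; first lra.
- by rewrite ler_wpM2r; lra.
- rewrite ler_wpM2r //; first lra.
  by rewrite ler_pdivrMr; lra.
- by rewrite mulrA Ts mulrC.
- rewrite mulrA mlp invfM mulrA /s invrK.
  by rewrite le_eqVlt; apply/orP; left; apply/eqP; field; lra.
Qed.

Lemma sink_exit_tail (R : realType) (N d z : R) m T l :
  regime N d m T -> (l <= m)%N -> z = l%:R / m%:R ->
  prob (iid (sink_law N m) m)
    (fun J => (z + d) * N <= (count id (take l J))%:R) <= expR (- (d ^+ 2 * N / 16)).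
Proof.
move=> reg; have [N2 d0 d1 m0 TN Nm] := reg.
have [/andP[s0 s1] p0 mp Ts mps] := regime_rates reg.
have d01 : 0 <= d <= 1 by rewrite ltW.
set s := source_rate N in s0 s1 Ts mps; set p := letter_rate R m in p0 mp mps.
have eS := symbol_law_expectation reg.
move=> lm zE; have eb := sink_law_expectation reg.
rewrite (prob_take (fun J => (z + d) * N <= (count id J)%:R) eb lm) mulrDl.
have M0 : 0 < m%:R :> R by rewrite ltr0n.
have z1 : z <= 1 by rewrite zE ler_pdivrMr // mul1r ler_nat.
apply: (count_upper_tail eb) => //; [lra|nra|].
rewrite prob_true -{1}[l%:R](divfK (lt0r_neq0 M0)) -zE -mulrA.
rewrite ler_wpM2l ?zE ?divr_ge0 ?ler0n //.
by rewrite -[leRHS]mps ler_wpM2l // sink_prob_le.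
Qed.

Lemma source_lower_tail (R : realType) (N d : R) m T : regime N d m T ->
  prob (iid (symbol_law N m) T)
    (fun w => (count is_source w)%:R <= (1 - d) * N - d * N) <=
  expR (- (d ^+ 2 * N / 16)).
Proof.
move=> reg; have [N2 d0 d1 m0 TN Nm] := reg.
have [/andP[s0 s1] p0 mp Ts mps] := regime_rates reg.
have d01 : 0 <= d <= 1 by rewrite ltW.
set s := source_rate N in s0 s1 Ts mps; set p := letter_rate R m in p0 mp mps.
have eS := symbol_law_expectation reg.
apply: (count_lower_tail eS) => //; rewrite ?prob_source ?Ts; try lra.
by nra.
Qed.

Lemma sink_lower_tail (R : realType) (N d : R) m T : regime N d m T ->
  prob (iid (sink_law N m) m)
    (fun J => (count id J)%:R <= (1 - d) * N - d * N) <= expR (- (d ^+ 2 * N / 16)).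
Proof.
move=> reg; have [N2 d0 d1 m0 TN Nm] := reg.
have [/andP[s0 s1] p0 mp Ts mps] := regime_rates reg.
have d01 : 0 <= d <= 1 by rewrite ltW.
set s := source_rate N in s0 s1 Ts mps; set p := letter_rate R m in p0 mp mps.
have M0 : 0 < m%:R :> R by rewrite ltr0n.
apply: (count_lower_tail (sink_law_expectation reg)) => //; rewrite ?prob_true; try lra.
  rewrite /sink_prob mulrA mp ler_pdivlMr -/s -/p; last by lra.
  have -> : s + p = (1 + N / m%:R) / (2 * N) by rewrite /s /p /source_rate /letter_rate; field; lra.
  have Nd : N / m%:R <= d by rewrite ler_pdivrMr.
  rewrite mulrA ler_pdivrMr; last lra.
  have : (1 - d) * (1 + N / m%:R) <= 1.
    apply: le_trans (_ : (1 - d) * (1 + d) <= _); last by nra.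
    by rewrite ler_wpM2l; lra.
  nra.
apply: le_trans (_ : m%:R * (p / s) <= _); first by rewrite ler_wpM2l // sink_prob_le.
by rewrite mps; lra.
Qed.

(** The total [G] is split as [S] on the boundary and [D] after the exit. The
    bounds on [S] and [D] add up to [2 - z ^+ 2 / 4] up to errors of order [d], so
    [z] is of order [sqrt d], and [S] is too small to matter. *)
Lemma exit_near_origin (R : realType) (N d e z G S D : R) :
  0 < N -> 0 <= e <= 1 -> d = e ^+ 2 / 100 ->
  0 <= z <= 1 -> (2 - 4 * d) * N < G -> G <= S + D -> S < (z + d) * N ->
  D < (exit_cost z + 2 * d) * N -> (2 - e) * N < D.
Proof.
move=> N_gt0 /andP[e0 e1] dE z01 lbG GSD ubS ubD.
have gap := exit_cost_gap z01.
(* 28 = 4 * (4 + 3): the losses in the lower bound on [G] and in the two upper bounds. *)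
have z2 : z ^+ 2 < 28 * d.
  suff : z ^+ 2 * N < 28 * d * N by rewrite ltr_pM2r.
  have : (z + exit_cost z) * N <= (2 - z ^+ 2 / 4) * N by rewrite ler_wpM2r // ltW.
  lra.
(* With [d = e ^+ 2 / 100], [28 * d = 0.28 * e ^+ 2] and [0.54 ^+ 2 > 0.28]. *)
have ze : z < 27 / 50 * e.
  rewrite ltNge; apply/negP => ez.
  have : (27 / 50 * e) ^+ 2 <= z ^+ 2.
    by rewrite ler_sqr ?nnegrE //; [lra|case/andP: z01].
  by rewrite dE in z2; nra.
apply: lt_le_trans (_ : (2 - 4 * d - z - d) * N <= _); last lra.
rewrite ltr_pM2r // dE; nra.
Qed.

(** A union bound over all exit points, and over the two parts of the total
    being too small. The number of exit points enters as a factor, harmless as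
    long as it is polynomial in [N]. *)
Lemma lis_lower_tail (R : realType) (N d e : R) m T : regime N d m T ->
  0 <= e <= 1 -> d = e ^+ 2 / 100 ->
  prob (iid (symbol_law N m) T)
    (fun w => (lis 0 (letters w))%:R <= (2 - e) * N) <=
  (3 * (T + m + 3))%:R * expR (- (d ^+ 2 * N / 16)).
Proof.
move=> reg; have [N2 d0 d1 m0 TN Nm] := reg.
have [/andP[s0 s1] p0 mp Ts mps] := regime_rates reg.
have d01 : 0 <= d <= 1 by rewrite ltW.
set s := source_rate N in s0 s1 Ts mps; set p := letter_rate R m in p0 mp mps.
move=> e01 dE.
set q := expR _.
have eW := iid_expectation T (symbol_law_expectation reg).
have eB := iid_expectation m (sink_law_expectation reg).
pose E := joint_mean (iid (symbol_law N m) T) (iid (sink_law N m) m).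
have eE : expectation _ E := joint_expectation eW eB.
have N_gt0 : 0 < N by lra.
(* The bad events: [P1] and [P2], one part of the total is too small; [Q1] to [Q4],
   a path gains too much before or after leaving one of the boundaries. *)
pose zT k : R := k%:R / T%:R; pose zm l : R := l%:R / m%:R.
pose low x := x%:R <= (1 - d) * N - d * N.
pose P1 (x : seq symbol * seq bool) := low (count is_source x.1).
pose P2 (x : seq symbol * seq bool) := low (count id (run x.2 x.1)).
pose Q1 k (x : seq symbol * seq bool) :=
  (zT k + d) * N <= (count is_source (take k x.1))%:R.
pose Q2 k (x : seq symbol * seq bool) :=
  (exit_cost (zT k) + 2 * d) * N <= (lis 0 (letters (drop k x.1)))%:R.
pose Q3 l (x : seq symbol * seq bool) :=
  (zm l + d) * N <= (count id (take l x.2))%:R.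
pose Q4 l (x : seq symbol * seq bool) :=
  (exit_cost (zm l) + 2 * d) * N <= (lis l (letters x.1))%:R.
have hP1 : prob E P1 <= q.
  rewrite (prob_joint1 (fun w => low (count is_source w)) eW eB).
  exact: source_lower_tail reg.
have hP2 : prob E P2 <= q.
  rewrite (prob_run T (fun J => low (count id J)) (ltW s0)) //.
  - exact: sink_lower_tail reg.
  - by rewrite mp; lra.
  - exact: sink_prob_balance.
  - exact: sink_prob_bounds.
have hQ k : (k < T.+1)%N -> prob E (fun x => Q1 k x || Q2 k x) <= 3 * q.
  move=> kT; apply: le_trans (prob_or _ _ eE) _.
  rewrite -[3]/(1 + 2)%:R natrD mulrDl mul1r lerD //.
    rewrite (prob_joint1 (fun w => (zT k + d) * N <= (count is_source (take k w))%:R) eW eB).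
    exact: (source_exit_tail reg).
  rewrite (prob_joint1 (fun w => (exit_cost (zT k) + 2 * d) * N <= (lis 0 (letters (drop k w)))%:R) eW eB).
  exact: (lis_drop_tail reg).
have hQ' l : (l < m.+1)%N -> prob E (fun x => Q3 l x || Q4 l x) <= 3 * q.
  move=> lm; apply: le_trans (prob_or _ _ eE) _.
  rewrite -[3]/(1 + 2)%:R natrD mulrDl mul1r lerD //.
    rewrite (prob_joint2 _ (fun J => (zm l + d) * N <= (count id (take l J))%:R) eW).
    exact: (sink_exit_tail reg).
  rewrite (prob_joint1 (fun w => (exit_cost (zm l) + 2 * d) * N <= (lis l (letters w))%:R) eW eB).
  exact: (lis_letters_tail reg).
have U := lerD (lerD hP1 hP2) (lerD (prob_has eE hQ) (prob_has eE hQ')).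
rewrite -(prob_joint1 (fun w => (lis 0 (letters w))%:R <= (2 - e) * N) eW eB).
apply: le_trans (_ : q + q + (T.+1%:R * (3 * q) + m.+1%:R * (3 * q)) <= _); last first.
  have q0 : 0 <= q by exact: expR_ge0.
  by rewrite natrM !natrD -natr1 -[m.+1%:R]natr1; nra.
apply: le_trans U.
apply: le_trans (lerD (prob_or _ _ eE) (prob_or _ _ eE)).
apply: le_trans (prob_or _ _ eE).
apply: (prob_sub eE) => -[w J] /andP[ww /andP[/eqP sJ _]] le_lis; rewrite /= in ww sJ le_lis.
have sw : size w = T by case/andP: ww => /eqP.
apply: contraTT le_lis; rewrite 3!negb_or -ltNge => /andP[/andP[n1 n2] /andP[nQ nQ']].
have G_gt : (2 - 4 * d) * N < (count is_source w + count id (run J w))%:R.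
  rewrite /P1 /P2 /low /= -?ltNge in n1 n2; rewrite natrD; lra.
have := @run_exit w J; rewrite sJ sw => /(_ (letters_below ww)).
have exit0 z S D : 0 <= z <= 1 ->
    (count is_source w + count id (run J w) <= S + D)%N ->
    S%:R < (z + d) * N -> D%:R < (exit_cost z + 2 * d) * N ->
    (2 - e) * N < D%:R.
  rewrite -(ler_nat R) [(S + D)%:R]natrD => z01 GSD ubS ubD.
  exact: (exit_near_origin N_gt0 e01 dE z01 G_gt GSD ubS ubD).
case=> [[l lm GSD]|[k kT GSD]].
  move/hasPn: nQ' => /(_ l); rewrite mem_iota ltnS lm => /(_ isT).
  rewrite negb_or /Q3 /Q4 /= -!ltNge => /andP[u1 u2].
  apply: lt_le_trans (exit0 _ _ _ _ GSD u1 u2) _.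
    by rewrite /zm divr_ge0 ?ler0n //= ler_pdivrMr ?ltr0n // mul1r ler_nat.
  by rewrite ler_nat lis_anti.
move/hasPn: nQ => /(_ k); rewrite mem_iota ltnS kT => /(_ isT).
rewrite negb_or /Q1 /Q2 /= -!ltNge => /andP[u1 u2].
apply: lt_le_trans (exit0 _ _ _ _ GSD u1 u2) _.
  have T0 : 0 < T%:R :> R by rewrite TN; nra.
  by rewrite /zT divr_ge0 ?ler0n //= ler_pdivrMr // mul1r ler_nat.
by rewrite ler_nat lis_drop.
Qed.

(** * Removing the steps that are not letters *)

Lemma pascal_sum (R : realType) T (f : nat -> R) :
  \sum_(0 <= k < T.+2) 'C(T.+1, k)%:R * f k =
  \sum_(0 <= k < T.+1) 'C(T, k)%:R * f k +
  \sum_(0 <= k < T.+1) 'C(T, k)%:R * f k.+1.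
Proof.
have -> : \sum_(0 <= k < T.+1) 'C(T, k)%:R * f k =
    \sum_(0 <= k < T.+2) 'C(T, k)%:R * f k.
  by rewrite [RHS]big_nat_recr //= bin_small // mul0r addr0.
rewrite [LHS]big_nat_recl // [X in _ = X + _]big_nat_recl // !bin0 -addrA.
rewrite -big_split /=; congr (_ + _).
by apply: eq_bigr => k _; rewrite binS natrD mulrDl.
Qed.

Definition letter_mean (R : realType) m (F : nat -> R) : R :=
  m%:R^-1 * \sum_(0 <= r < m) F r.

Lemma letter_expectation (R : realType) m : (0 < m)%N ->
  expectation (fun r => r < m)%N (letter_mean m : (nat -> R) -> R).
Proof.
move=> m0; have M0 : 0 < m%:R :> R by rewrite ltr0n.
split; rewrite /letter_mean.
- move=> F G FG; rewrite ler_wpM2l ?invr_ge0 ?ler0n //.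
  by apply: ler_sum_nat => r /andP[_ rm]; apply: FG.
- by move=> c F G; rewrite big_split /= -mulr_sumr; ring.
- by rewrite sumr_const_nat subn0 -[1 *+ m]/(m%:R) mulVf ?lt0r_neq0.
Qed.

(** With letters of total probability [1 / 2], their number is binomial and,
    given their number, they form a uniform word. *)
Lemma iid_letters (R : realType) (s p : R) m T (F : seq nat -> R) :
  (0 < m)%N -> m%:R * p = 1 / 2 ->
  iid (symbol_mean s p m) T (fun w => F (letters w)) =
  \sum_(0 <= k < T.+1) 'C(T, k)%:R * ((1 / 2) ^+ T * iid (letter_mean m) k F).
Proof.
move=> m0 mp; have M0 : m%:R != 0 :> R by rewrite pnatr_eq0 -lt0n.
elim: T F => [|T IHT] F.
  by rewrite big_nat1 bin0 expr0 !mul1r.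
rewrite /= pascal_sum {1}/symbol_mean /=.
set e := iid _ T (fun w => F (letters w)).
have -> : \sum_(0 <= r < m) iid (symbol_mean s p m) T (fun w => F (r :: letters w)) =
    m%:R * \sum_(0 <= k < T.+1) 'C(T, k)%:R * ((1 / 2) ^+ T * iid (letter_mean m) k.+1 F).
  rewrite (eq_bigr _ (fun r _ => IHT (fun x => F (r :: x)))).
  rewrite exchange_big /= mulr_sumr; apply: eq_bigr => k _.
  rewrite -mulr_sumr -mulr_sumr /letter_mean /=.
  by field.
rewrite mulrA [p * _]mulrC mp exprS.
transitivity (1 / 2 * e + 1 / 2 * \sum_(0 <= k < T.+1) 'C(T, k)%:R *
   ((1 / 2) ^+ T * iid (letter_mean m) k.+1 F)).
  by field.
by rewrite /e IHT !mulr_sumr; congr (_ + _); apply: eq_bigr => k _ /=; ring.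
Qed.

(** By the symmetry of the binomial coefficients, the middle term being counted
    on both sides. *)
Lemma half_binomial n :
  (2 ^ (2 * n) <= 2 * \sum_(n <= k < (2 * n).+1) 'C(2 * n, k))%N /\
  (2 ^ (2 * n) <= 2 * \sum_(0 <= k < n.+1) 'C(2 * n, k))%N.
Proof.
have n2 : (n <= (2 * n).+1)%N by rewrite ltnW // ltnS leq_pmull.
have tot : (\sum_(0 <= k < (2 * n).+1) 'C(2 * n, k) = 2 ^ (2 * n))%N.
  rewrite -[X in (X ^ _)%N]/(1 + 1)%N expnDn big_mkord.
  by apply: eq_bigr => k _; rewrite !exp1n !muln1.
have refl : (\sum_(n <= k < (2 * n).+1) 'C(2 * n, k) = \sum_(0 <= k < n.+1) 'C(2 * n, k))%N.
  rewrite big_nat_rev /= -{1}[n]add0n big_addn.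
  have -> : ((2 * n).+1 - n = n.+1)%N by rewrite mul2n -addnn -addnS addKn.
  apply: eq_big_nat => k /andP[_ kn].
  rewrite -[RHS]bin_sub; last lia.
  by congr ('C(_, _)); lia.
have split2 := big_cat_nat (op := addn) (F := fun k => 'C(2 * n, k)) (P := predT) (leq0n n) n2.
rewrite /= tot in split2.
have le : (\sum_(0 <= k < n) 'C(2 * n, k) <= \sum_(0 <= k < n.+1) 'C(2 * n, k))%N.
  by rewrite big_nat_recr //= leq_addr.
rewrite -refl in le *; rewrite split2; split; lia.
Qed.

(** A word of [2 * n] steps has at least [n] letters with probability at least
    [1 / 2], and at most [n] letters too. Depending on the direction in which
    [F] is monotone, one half or the other is kept. *)
Lemma iid_letters_ge (R : realType) (s p : R) m n (F : seq nat -> R) :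
  (0 < m)%N -> m%:R * p = 1 / 2 -> (forall x, 0 <= F x) ->
  (forall r x, F x <= F (r :: x)) \/ (forall r x, F (r :: x) <= F x) ->
  iid (letter_mean m) n F <=
  2 * iid (symbol_mean s p m) (2 * n) (fun w => F (letters w)).
Proof.
move=> m0 mp F0 Fmono; rewrite (iid_letters _ _ _ m0 mp).
have eL := letter_expectation R m0.
pose v k : R := iid (letter_mean m) k F.
have v0 k : 0 <= v k.
  rewrite -(mean_cst 0 (iid_expectation k eL)).
  by apply: (mean_le (iid_expectation k eL)) => x _.
(* A new letter is put in front of the word, so monotony in the number of letters
   follows from that of [F]. *)
have vS_mono : (forall k, v k <= v k.+1) \/ (forall k, v k.+1 <= v k).
  case: Fmono => FS; [left|right] => k; rewrite /v.
    rewrite -[leLHS](mean_cst _ eL) /=; apply: (mean_le eL) => r _.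
    by apply: (mean_le (iid_expectation k eL)) => x _.
  rewrite -[leRHS](mean_cst _ eL) /=; apply: (mean_le eL) => r _.
  by apply: (mean_le (iid_expectation k eL)) => x _.
have [half1 half2] := half_binomial n.
suff key a c : (0 <= a)%N -> (a <= c <= (2 * n).+1)%N ->
    (forall k, (a <= k < c)%N -> v n <= v k) ->
    (2 ^ (2 * n) <= 2 * \sum_(a <= k < c) 'C(2 * n, k))%N ->
    v n <= 2 * \sum_(0 <= k < (2 * n).+1) 'C(2 * n, k)%:R * ((1 / 2) ^+ (2 * n) * v k).
  have n2 : (n <= 2 * n)%N by rewrite leq_pmull.
  case: vS_mono => vS.
    apply: (key n (2 * n).+1) => //; first by rewrite leqnn andbT ltnW.
    move=> k /andP[nk _]; rewrite -(subnKC nk).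
    by elim: (k - n)%N => [|j IHj]; rewrite ?addn0 // addnS (le_trans IHj).
  apply: (key 0 n.+1) => //= k; rewrite ltnS => kn; rewrite -(subnKC kn).
  by elim: (n - k)%N => [|j IHj]; rewrite ?addn0 // addnS (le_trans _ IHj).
move=> _ /andP[ac c2] vle; rewrite -(ler_nat R) => half.
set t := (1 / 2) ^+ (2 * n).
have t0 : 0 <= t by rewrite exprn_ge0 //; lra.
have t1 : (2 ^ (2 * n))%:R * t = 1 :> R.
  by rewrite natrX -exprMn mulrC divfK ?expr1n // pnatr_eq0.
apply: le_trans (_ : 2 * \sum_(a <= k < c) 'C(2 * n, k)%:R * (t * v k) <= _); last first.
  rewrite ler_wpM2l // [leRHS](big_cat_nat (n := a)) //=; last exact: leq_trans c2.
  rewrite [X in _ <= _ + X](big_cat_nat (n := c)) //=.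
  rewrite addrCA lerDl addr_ge0 // sumr_ge0 // => k _;
  by rewrite mulr_ge0 ?ler0n ?mulr_ge0.
apply: le_trans (_ : 2 * \sum_(a <= k < c) 'C(2 * n, k)%:R * (t * v n) <= _); last first.
  rewrite ler_wpM2l //; apply: ler_sum_nat => k kac.
  by rewrite ler_wpM2l ?ler0n // ler_wpM2l ?vle.
rewrite -mulr_suml -natr_sum mulrA -natrM mulrA.
by rewrite -[leLHS]mul1r ler_wpM2r // -[leLHS]t1 ler_wpM2r.
Qed.

(** * From uniform words to uniform permutations *)

Notation increasing := (fun i j : 'I__ => i < j)%N.

(** LIS and LDS, and their analogues for words, are instances of this one
    quantity, for different relations on the positions. *)
Definition chain_max n (r : rel 'I_n) : nat :=
  (\max_(k < n.+1 | [exists t : k.-tuple 'I_n,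
      sorted increasing t && sorted r t]) k)%N.

Lemma LIS_chain n (s : 'S_n) : LIS s = chain_max (fun i j => s i < s j)%N.
Proof.
by apply: eq_bigl => k; apply: eq_existsb => t; rewrite sorted_map.
Qed.

Lemma LDS_chain n (s : 'S_n) : LDS s = chain_max (fun i j => s j < s i)%N.
Proof.
by apply: eq_bigl => k; apply: eq_existsb => t; rewrite sorted_map.
Qed.

Lemma eq_chain_max n (r r' : rel 'I_n) : r =2 r' -> chain_max r = chain_max r'.
Proof.
move=> rr'; apply: eq_bigl => k; apply: eq_existsb => t.
by rewrite (eq_sorted rr').
Qed.

Lemma increasing_trans n : transitive (increasing : rel 'I_n).
Proof. by move=> j i k /=; apply: ltn_trans. Qed.

(** Positions in increasing order are determined by the set that they form. *)
Lemma increasing_subseq n (u : seq 'I_n) :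
  sorted increasing u -> subseq u (enum 'I_n).
Proof.
move=> incr_u.
suff -> : u = [seq i <- enum 'I_n | i \in u] by exact: filter_subseq.
apply: (irr_sorted_eq (@increasing_trans n)) => //.
- by move=> i /=; rewrite ltnn.
- apply: (sorted_filter (@increasing_trans n)).
  have := iota_ltn_sorted 0 n; rewrite -val_enum_ord sorted_map.
  by apply: sub_sorted.
- by move=> i; rewrite mem_filter mem_enum andbT.
Qed.

Lemma chain_max_ge n (r : rel 'I_n) u :
  sorted increasing u -> sorted r u -> (size u <= chain_max r)%N.
Proof.
move=> incr_u ru.
have un : (size u < n.+1)%N.
  by rewrite ltnS -{2}(size_enum_ord n) size_subseq // increasing_subseq.
apply: (@bigop.leq_bigmax_cond _ _ (fun k : 'I_n.+1 => k : nat) (Ordinal un)).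
apply/existsP; exists (in_tuple u).
by rewrite incr_u.
Qed.

Lemma chain_max_attained n (r : rel 'I_n) :
  exists u, [/\ sorted increasing u, sorted r u & size u = chain_max r].
Proof.
have ex0 : [exists t : 0.-tuple 'I_n, sorted increasing t && sorted r t].
  by apply/existsP; exists [tuple].
have [/= k /existsP[t /andP[incr_t rt]] maxk] := eq_bigmax_cond (fun k : 'I_n.+1 => k : nat)
   (A := fun k : 'I_n.+1 => [exists t : k.-tuple 'I_n, sorted increasing t && sorted r t])
   (introT (card_gt0P) (ex_intro _ ord0 ex0)).
by exists t; split=> //; rewrite size_tuple -maxk.
Qed.

Lemma lis_ge lo x y : subseq y x -> sorted ltn y -> all (leq lo) y ->
  (size y <= lis lo x)%N.
Proof.
elim: x lo y => [|r x IHx] lo [|b y] //=.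
case: eqP => [->|_] sub_y.
  move=> path_y /andP[lo_r _]; rewrite lo_r leq_max ltnS IHx ?orbT //.
    exact: path_sorted path_y.
  exact: order_path_min ltn_trans path_y.
move=> path_y lo_y; have le_y := IHx lo _ sub_y path_y lo_y.
by case: ifP => // _; rewrite leq_max le_y.
Qed.

Lemma lis_attained lo x :
  exists y, [/\ subseq y x, sorted ltn y, all (leq lo) y & size y = lis lo x].
Proof.
elim: x lo => [|r x IHx] lo; first by exists [::].
have [y [sub_y incr_y lo_y sz_y]] := IHx lo.
have skip : subseq y (r :: x) by apply: subseq_trans sub_y (subseq_cons _ _).
rewrite /=; case: ifP => [lo_r|_]; last by exists y.
case: (leqP (lis r.+1 x).+1 (lis lo x)) => _; first by exists y.
have [z [sub_z incr_z r_z sz_z]] := IHx r.+1.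
exists (r :: z); split; rewrite /= ?eqxx ?lo_r ?sz_z //.
  by rewrite path_min_sorted.
by apply: sub_all r_z => k rk; rewrite (leq_trans lo_r) // ltnW.
Qed.

Lemma chain_max_lis n (g : 'I_n -> nat) :
  chain_max (fun i j => g i < g j)%N = lis 0 (map g (enum 'I_n)).
Proof.
apply/eqP; rewrite eqn_leq; apply/andP; split.
  have [u [incr_u gu <-]] := chain_max_attained (fun i j => g i < g j)%N.
  rewrite -(size_map g) lis_ge ?map_subseq ?increasing_subseq //.
  - by rewrite sorted_map.
  - exact/allP.
have [y [/subseqP[b sb yE] incr_y _ <-]] := lis_attained 0 (map g (enum 'I_n)).
rewrite yE -map_mask size_map; apply: chain_max_ge; last first.
  by move: incr_y; rewrite yE -map_mask sorted_map.
apply: (subseq_sorted (@increasing_trans n) (mask_subseq b _)).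
have := iota_ltn_sorted 0 n; rewrite -val_enum_ord sorted_map.
by apply: sub_sorted.
Qed.

Lemma rank_subproof n (g : 'I_n -> nat) (i : 'I_n) :
  (#|[set j | g j < g i]%N| < n)%N.
Proof.
rewrite -[X in (_ < X)%N](card_ord n) -cardsT proper_card //.
apply/properP; split; first exact: finset.subsetT.
by exists i; rewrite !inE // ltnn.
Qed.

(** The standardisation of an injective word: the permutation in the same
    relative order. *)
Definition rank n (g : 'I_n -> nat) (i : 'I_n) : 'I_n := Ordinal (rank_subproof g i).

Lemma rank_lt n (g : 'I_n -> nat) i j : injective g ->
  (rank g i < rank g j)%N = (g i < g j)%N.
Proof.
move=> g_inj; have lt_rank a b : (g a < g b)%N -> (rank g a < rank g b)%N.
  move=> ab; apply: proper_card; apply/properP; split.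
    by apply/fintype.subsetP => k; rewrite !inE => /ltn_trans; apply.
  by exists a; rewrite !inE ?ltnn.
apply/idP/idP; last exact: lt_rank.
case: (ltngtP (g i) (g j)) => // [/lt_rank|/g_inj->]; last by rewrite ltnn.
by move=> /ltnW; rewrite leqNgt => /negbTE->.
Qed.

Lemma rank_inj n (g : 'I_n -> nat) : injective g -> injective (rank g).
Proof.
move=> g_inj i j /(congr1 val) /= eq_rank; apply: (g_inj); apply/eqP.
have := rank_lt i j g_inj; have := rank_lt j i g_inj.
by rewrite /= eq_rank ltnn; case: ltngtP.
Qed.

Lemma big_tupleS (R : realType) (A : finType) n (G : seq A -> R) :
  \sum_(t : n.+1.-tuple A) G t = \sum_a \sum_(t : n.-tuple A) G (a :: t).
Proof.
rewrite pair_bigA /= (reindex (fun x : (A * n.-tuple A)%type => [tuple of x.1 :: x.2])) //.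
exists (fun t : n.+1.-tuple A => (thead t, [tuple of behead t])).
  by move=> [a t] _; congr (_, _); apply: val_inj.
by move=> t _ /=; rewrite -tuple_eta.
Qed.

Lemma iid_tuples (R : realType) m n (F : seq nat -> R) :
  iid (letter_mean m) n F =
  m%:R ^- n * \sum_(t : n.-tuple 'I_m) F (map val t).
Proof.
elim: n F => [|n IHn] F /=.
  rewrite expr0 invr1 mul1r (eq_bigl (pred1 [tuple])) ?big_pred1_eq // => t.
  by rewrite [t]tuple0 /= eqxx.
rewrite (big_tupleS _ (fun x : seq 'I_m => F (map val x))) exprS invfM /letter_mean -mulrA.
congr (_ * _); rewrite mulr_sumr big_mkord; apply: eq_bigr => a _.
exact: (IHn (fun x => F (val a :: x))).
Qed.

Definition permute_tuple n A (s : 'S_n) (t : n.-tuple A) : n.-tuple A :=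
  [tuple tnth t (s i) | i < n].

Lemma permute_tuple_bij n A (s : 'S_n) : bijective (@permute_tuple n A s).
Proof.
exists (@permute_tuple n A s^-1%g) => t; apply: eq_from_tnth => i;
by rewrite !tnth_mktuple ?permK ?permKV.
Qed.

Lemma uniq_permute_tuple n (A : eqType) (s : 'S_n) (t : n.-tuple A) :
  uniq (permute_tuple s t) = uniq t.
Proof.
apply/tuple_uniqP/tuple_uniqP => inj_t i j.
  rewrite -(permKV s i) -(permKV s j) => tij.
  by have -> // := inj_t (s^-1 i)%g (s^-1 j)%g; rewrite !tnth_mktuple.
by rewrite !tnth_mktuple => /inj_t /perm_inj.
Qed.

(** Shuffling the letters of an injective word gives, up to standardisation,
    each permutation once. *)
Lemma sum_perm_lis (R : realType) n m (t : n.-tuple 'I_m) (F : nat -> R) : uniq t ->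
  \sum_(s : 'S_n) F (lis 0 (map val (permute_tuple s t))) =
  \sum_(s : 'S_n) F (LIS s).
Proof.
move=> uniq_t; pose g i := val (tnth t i).
have g_inj : injective g by move=> i j /val_inj /(tuple_uniqP _ uniq_t).
rewrite [RHS](reindex_inj (mulIg (perm (rank_inj g_inj)))).
apply: eq_bigr => s _; congr F; rewrite LIS_chain /=.
have -> : map val (permute_tuple s t) = map (fun i => g (s i)) (enum 'I_n).
  by rewrite -map_comp.
rewrite -chain_max_lis; apply: eq_chain_max => i j.
by rewrite !permM !permE rank_lt.
Qed.

(** Each new factor [m - k] loses at most the fraction [k / m]; these fractions
    add up to less than [k ^ 2 / m]. *)
Lemma ffact_lower (m k : nat) : (k <= m)%N ->
  (m ^_ k <= m ^ k <= m ^_ k + k ^ 2 * m ^ k.-1)%N.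
Proof.
elim: k => [|k IHk] km; first by rewrite ffactn0 expn0.
have /andP[le1 le2] := IHk (ltnW km).
rewrite ffactnSr expnSr leq_mul ?leq_subr //=.
have kmk : (k ^ 2 * m ^ k.-1 * m = k ^ 2 * m ^ k)%N.
  by case: (k) => [|j]; rewrite ?mul0n // -mulnA -expnSr.
apply: leq_trans (leq_mul le2 (leqnn m)) _; rewrite mulnDl kmk mulnBr.
have : (m ^_ k * k <= m ^ k * k)%N by rewrite leq_mul2r le1 orbT.
have : (m ^_ k * k <= m ^_ k * m)%N by rewrite leq_mul2l ltnW ?orbT.
nia.
Qed.

(** When [m] is large, at least half of the words are injective. *)
Lemma uniform_perm_le_words (R : realType) n m (F : nat -> R) :
  (0 < m)%N -> (2 * n ^ 2 <= m)%N -> (forall k, 0 <= F k) ->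
  (n`!)%:R^-1 * \sum_(s : 'S_n) F (LIS s) <=
  2 * iid (letter_mean m) n (fun x => F (lis 0 x)).
Proof.
move=> m0 nm F0; rewrite iid_tuples.
have M0 : 0 < m%:R :> R by rewrite ltr0n.
have nf0 : 0 < (n`!)%:R :> R by rewrite ltr0n fact_gt0.
set W := \sum_(t : n.-tuple 'I_m) _; set Sn := \sum_(s : 'S_n) _.
have Sn0 : 0 <= Sn by apply: sumr_ge0.
pose U := \sum_(t : n.-tuple 'I_m | uniq t) F (lis 0 (map val t)).
have UW : U <= W.
  by rewrite /W (bigID (fun t : n.-tuple _ => uniq t)) lerDl sumr_ge0.
(* Sum over the injective words and over their shuffles, in both orders. *)
have symm : Sn *+ m ^_ n = U *+ n`!.
  transitivity (\sum_(s : 'S_n) \sum_(t : n.-tuple 'I_m | uniq t)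
      F (lis 0 (map val (permute_tuple s t)))).
    rewrite exchange_big /= (eq_bigr (fun=> Sn)) => [|t uniq_t]; last first.
      exact: sum_perm_lis.
    rewrite sumr_const; congr (_ *+ _).
    rewrite -[m in LHS]card_ord -card_uniq_tuples cardsE.
    by apply: eq_card => t; rewrite !unfold_in /= all_predT.
  rewrite (eq_bigr (fun=> U)) => [|s _]; last first.
    rewrite /U [RHS](reindex _ (onW_bij _ (permute_tuple_bij _ s))).
    by apply: eq_bigl => t; rewrite uniq_permute_tuple.
  by rewrite sumr_const card_Sn.
have ffact_ge : m%:R ^+ n <= 2 * (m ^_ n)%:R :> R.
  rewrite -natrX -natrM ler_nat.
  have nm' : (n <= m)%N by apply: leq_trans nm; nia.
  have /andP[_ le2] := ffact_lower nm'.
  case: (posnP n) => [->|n0]; first by rewrite ffactn0 expn0.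
  have : (2 * n ^ 2 * m ^ n.-1 <= m ^ n)%N.
    have -> : (m ^ n = m * m ^ n.-1)%N by rewrite -expnS prednK.
    by rewrite leq_mul2r nm orbT.
  by rewrite -mulnA; lia.
have Mn0 : 0 < m%:R ^+ n :> R by rewrite exprn_gt0.
have le1 : (m ^_ n)%:R * Sn <= (n`!)%:R * W.
  by rewrite !mulr_natl symm ler_wMn2r.
rewrite ler_pdivrMl // mulrCA [m%:R ^- n * W]mulrC 2!mulrA ler_pdivlMr //.
apply: le_trans (_ : Sn * (2 * (m ^_ n)%:R) <= _); first by rewrite ler_wpM2l.
by rewrite mulrCA -mulrA ler_wpM2l // mulrC.
Qed.

(** * Concentration for uniform permutations *)

Definition perm_mean (R : realType) n (F : 'S_n -> R) : R :=
  (n`!)%:R^-1 * \sum_(s : 'S_n) F s.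

Lemma perm_expectation (R : realType) n :
  expectation predT (@perm_mean R n).
Proof.
have nf0 : 0 < (n`!)%:R :> R by rewrite ltr0n fact_gt0.
split; rewrite /perm_mean.
- by move=> F G FG; rewrite ler_wpM2l ?invr_ge0 ?ler0n // ler_sum // => s _; apply: FG.
- by move=> c F G; rewrite big_split /= -mulr_sumr; ring.
- by rewrite sumr_const card_Sn -[1 *+ _]/(_%:R) mulVf ?lt0r_neq0.
Qed.

(** Faster than any power of [n]. As LIS is at most [n], an event of rapidly
    decreasing probability contributes nothing to any of its moments in the limit. *)
Definition rapid (R : realType) (r : nat -> R) : Prop :=
  forall k : nat, exists C, forall n, n%:R ^+ k * r n <= C.

Lemma rapidD (R : realType) (r r' : nat -> R) :
  rapid r -> rapid r' -> rapid (fun n => r n + r' n).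
Proof.
move=> rr rr' k; have [C rC] := rr k; have [C' rC'] := rr' k.
by exists (C + C') => n; rewrite mulrDr lerD.
Qed.

Lemma rapid_le (R : realType) (r r' : nat -> R) :
  (forall n, r n <= r' n) -> rapid r' -> rapid r.
Proof.
move=> le_r rr' k; have [C rC] := rr' k; exists C => n.
by apply: le_trans (rC n); rewrite ler_wpM2l // exprn_ge0.
Qed.

(** From [y <= expR y], applied to [y = c * sqrt n / (2 * k)] and raised to the
    power [2 * k]. *)
Lemma expR_sqrt_ge (R : realType) (c : R) n k : 0 < c -> (0 < k)%N ->
  (c / (2 * k)%:R) ^+ (2 * k) * n%:R ^+ k <= expR (c * Num.sqrt n%:R).
Proof.
move=> c0 k0; have K0 : 0 < (2 * k)%:R :> R by rewrite ltr0n muln_gt0.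
set y := c * Num.sqrt n%:R / (2 * k)%:R.
have y0 : 0 <= y by rewrite divr_ge0 ?ler0n // mulr_ge0 ?sqrtr_ge0 // ltW.
have -> : c * Num.sqrt n%:R = (2 * k)%:R * y by rewrite /y [RHS]mulrC divfK ?lt0r_neq0.
rewrite expRM_natl; apply: le_trans (_ : y ^+ (2 * k) <= _); last first.
  rewrite lerXn2r ?nnegrE ?expR_ge0 //.
  by apply: le_trans (expR_ge1Dx _); rewrite lerDr.
by rewrite /y mulrAC [leRHS]exprMn [in leRHS](exprM (Num.sqrt _)) sqr_sqrtr.
Qed.

Lemma rapid_exp_sqrt (R : realType) (r : nat -> R) (K c : R) j n0 :
  0 < c -> (forall n, r n <= 1) ->
  (forall n, (n0 <= n)%N -> r n <= K * n%:R ^+ j * expR (- (c * Num.sqrt n%:R))) ->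
  rapid r.
Proof.
move=> c0 r1 rexp k; set a := (c / (2 * (k + j).+1)%:R) ^+ (2 * (k + j).+1).
have a0 : 0 < a by rewrite exprn_gt0 // divr_gt0 // ltr0n.
exists (n0.+1%:R ^+ k + `|K| / a) => n.
case: (ltnP n n0.+1) => [nn0|n0n].
  apply: le_trans (_ : n0.+1%:R ^+ k <= _); last by rewrite lerDl divr_ge0 // ltW.
  apply: le_trans (_ : n%:R ^+ k * 1 <= _); first by rewrite ler_wpM2l ?exprn_ge0.
  by rewrite mulr1 lerXn2r ?nnegrE ?ler0n // ler_nat ltnW.
apply: le_trans (_ : `|K| / a <= _); last by rewrite lerDr exprn_ge0.
rewrite ler_pdivlMr // mulrC.
apply: le_trans (_ : a * (n%:R ^+ k * (K * n%:R ^+ j * expR (- (c * Num.sqrt n%:R)))) <= _).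
  by rewrite (ler_wpM2l (ltW a0)) // ler_wpM2l ?exprn_ge0 // rexp // ltnW.
rewrite expRN.
have -> : a * (n%:R ^+ k * (K * n%:R ^+ j / expR (c * Num.sqrt n%:R))) =
    K * (a * n%:R ^+ (k + j)) / expR (c * Num.sqrt n%:R) by rewrite exprD; ring.
rewrite ler_pdivrMr ?expR_gt0 //.
apply: le_trans (_ : `|K| * (a * n%:R ^+ (k + j)) <= _).
  by rewrite ler_wpM2r ?ler_norm // (mulr_ge0 (ltW a0)) // exprn_ge0.
rewrite ler_wpM2l //.
apply: le_trans (expR_sqrt_ge n c0 (ltn0Sn (k + j))).
by rewrite (ler_wpM2l (ltW a0)) // ler_weXn2l // ler1n (leq_ltn_trans _ n0n).
Qed.

(** One factor [2] is lost for the number of letters, one for their repetitions. *)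
Lemma perm_prob_le_symbol_law (R : realType) n m (N d : R) (P : nat -> bool) :
  regime N d m (2 * n) -> (2 * n ^ 2 <= m)%N ->
  (forall x y, (x <= y)%N -> P x -> P y) \/ (forall x y, (x <= y)%N -> P y -> P x) ->
  prob (@perm_mean R n) (fun s => P (LIS s)) <=
  4 * prob (iid (symbol_law N m) (2 * n)) (fun w => P (lis 0 (letters w))).
Proof.
move=> reg nm Pmono; have m0 := regime_m reg.
have [_ _ mp _ _] := regime_rates reg.
apply: le_trans (uniform_perm_le_words (F := fun k => (P k)%:R) m0 nm _) _ => //.
rewrite [X in _ <= X * _](_ : 4 = 2 * 2); last by ring.
rewrite -mulrA ler_wpM2l //.
have le_lis r x : (lis 0 x <= lis 0 (r :: x))%N by rewrite /= leq_max leqnn.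
rewrite /prob /symbol_law.
apply: (iid_letters_ge (F := fun x => (P (lis 0 x))%:R) _ _ m0 mp) => [x|]; first exact: ler0n.
case: Pmono => PP; [left|right] => r x; rewrite ler_nat.
  by case: (P (lis 0 x)) (PP _ _ (le_lis r x)) => [->|].
by case: (P (lis 0 (r :: x))) (PP _ _ (le_lis r x)) => [->|].
Qed.

Definition deviates (R : realType) (e : R) n x : bool :=
  e * Num.sqrt n%:R < `|x%:R - 2 * Num.sqrt n%:R|.

(** The alphabet has [2 * n ^ 2] letters, enough for uniform words to be mostly
    injective and few enough for the union bound over exit points. *)
Lemma LIS_concentration (R : realType) (e : R) : 0 < e ->
  rapid (fun n => prob (@perm_mean R n) (fun s => deviates e n (LIS s))).
Proof.
move=> e_gt0; wlog e_le1 : e e_gt0 / e <= 1 => [wlog_e|].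
  case: (leP e 1) => [|e1]; first exact: wlog_e.
  apply: rapid_le (wlog_e 1 ltr01 (lexx 1)) => n.
  apply: (prob_sub (perm_expectation R n)) => s _; apply: le_lt_trans.
  by rewrite ler_wpM2r ?sqrtr_ge0 // ltW.
pose d := e ^+ 2 / 100; have dE : d = e ^+ 2 / 100 by [].
have d0 : 0 < d by rewrite divr_gt0 // exprn_gt0.
have d_le : 50 * d <= e by rewrite dE; nra.
clearbody d.
(* [n0] makes the alphabet large enough for [regime_Nm]. *)
pose n0 := (Num.truncn d^-1).+1.
have n0d : 1 <= d * n0%:R.
  by rewrite -ler_pdivrMl // mulr1 ltW // truncnS_gt.
(* [100 * n ^+ 2] bounds [4 * 3 * (2 * n + 2 * n ^+ 2 + 3) + 8] for [n >= 4]. *)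
apply: (@rapid_exp_sqrt _ _ 100 (d ^+ 2 / 16) 2 (n0 + 4)).
- by rewrite divr_gt0 // exprn_gt0.
- by move=> n; apply: prob_le1 (perm_expectation R n).
move=> n nn0; pose N : R := Num.sqrt n%:R; pose m := (2 * n ^ 2)%N.
have N2E : N ^+ 2 = n%:R by rewrite sqr_sqrtr.
have N0 : 0 <= N by exact: sqrtr_ge0.
have n4 : 4 <= n%:R :> R by rewrite (ler_nat R 4); apply: leq_trans nn0; rewrite leq_addl.
have N2 : 2 <= N by nra.
have reg : regime N d m (2 * n).
  split=> //; [lra | rewrite /m; lia | by rewrite natrM N2E |].
  rewrite /m natrM natrX -N2E.
  have : 1 <= d * N ^+ 2.
    apply: le_trans n0d _; rewrite N2E (ler_wpM2l (ltW d0)) // ler_nat.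
    by apply: leq_trans nn0; rewrite leq_addr.
  nra.
set q := expR (- (d ^+ 2 / 16 * N)).
have qE : expR (- (d ^+ 2 * N / 16)) = q by rewrite /q; congr expR; ring.
have q0 : 0 <= q by exact: expR_ge0.
have low : prob (@perm_mean R n) (fun s => (LIS s)%:R <= (2 - e) * N) <=
    4 * ((3 * (2 * n + m + 3))%:R * q).
  apply: le_trans (perm_prob_le_symbol_law (P := fun x => x%:R <= (2 - e) * N) reg (leqnn _) _) _.
    by right=> x y xy; apply: le_trans; rewrite ler_nat.
  by rewrite ler_wpM2l // -qE (lis_lower_tail reg) // ltW.
have up : prob (@perm_mean R n) (fun s => N + N + 2 * (d * N) <= (LIS s)%:R) <=
    4 * (2 * q).
  apply: le_trans (perm_prob_le_symbol_law (P := fun x => N + N + 2 * (d * N) <= x%:R) reg (leqnn _) _) _.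
    by left=> x y xy /le_trans; apply; rewrite ler_nat.
  have [/andP[s0 s1] p0 mp Ts mps] := regime_rates reg.
  rewrite ler_wpM2l // -qE; apply: lis_upper_tail => //; rewrite ?Ts ?mps ?mp //; lra.
apply: le_trans (_ : _ <= 4 * ((3 * (2 * n + m + 3))%:R * q) + 4 * (2 * q)) _.
  apply: le_trans (lerD low up).
  apply: le_trans (prob_or _ _ (perm_expectation R n)).
  apply: (prob_sub (perm_expectation R n)) => s _.
  have dN : 2 * (d * N) <= e * N by rewrite mulrA ler_wpM2r //; lra.
  by rewrite /deviates -/N ltr_normr => /orP[] H; apply/orP; [right|left]; lra.
rewrite mulrA [4 * (2 * q)]mulrA -mulrDl ler_wpM2r // /m !natrM !natrD !natrM.
nra.
Qed.

(** * Cycles, conjugation and the number of changed values *)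

Definition num_diff n (s s' : 'S_n) : nat := #|[set i | s i != s' i]|.

Lemma num_diffC n (s s' : 'S_n) : num_diff s s' = num_diff s' s.
Proof. by apply: eq_card => i; rewrite !inE eq_sym. Qed.

Lemma num_diff_triangle n (s s' s'' : 'S_n) :
  (num_diff s s'' <= num_diff s s' + num_diff s' s'')%N.
Proof.
apply: leq_trans (leq_card_setU _ _); apply/subset_leq_card/fintype.subsetP => i.
by rewrite !inE; apply: contraNT; rewrite negb_or !negbK => /andP[/eqP->].
Qed.

Lemma num_diff_conj n (s s' u : 'S_n) :
  num_diff (s ^ u)%g (s' ^ u)%g = num_diff s s'.
Proof.
rewrite /num_diff -(card_imset [set i | s i != s' i] (@perm_inj _ u)).
apply: eq_card => i; rewrite -(permKV u i) mem_imset ?inE; last exact: perm_inj.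
by rewrite !permJ (inj_eq perm_inj).
Qed.

(** Remove from an optimal chain the positions where the permutations differ. *)
Lemma chain_max_lipschitz n (r : rel 'I_n) (s s' : 'S_n) : transitive r ->
  (chain_max (fun i j => r (s i) (s j)) <=
   chain_max (fun i j => r (s' i) (s' j)) + num_diff s s')%N.
Proof.
move=> r_tr; have [u [incr_u ru <-]] := chain_max_attained (fun i j => r (s i) (s j)).
pose v := [seq i <- u | s i == s' i].
have incr_v : sorted (fun i j : 'I_n => i < j)%N v.
  exact: (sorted_filter (@increasing_trans n)).
have rv : sorted (fun i j => r (s' i) (s' j)) v.
  have : sorted r (map s v).
    by rewrite sorted_map; apply: sorted_filter ru => j i k /=; apply: r_tr.
  have -> : map s v = map s' v.
    by apply/eq_in_map => i; rewrite mem_filter => /andP[/eqP].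
  by rewrite sorted_map.
apply: leq_trans (leq_add (chain_max_ge incr_v rv) (leqnn _)).
rewrite -(count_predC (fun i => s i == s' i) u) size_filter leq_add2l -size_filter.
have uniq_u : uniq u by apply: (sorted_uniq (@increasing_trans n)) incr_u => i /=; rewrite ltnn.
rewrite -(card_uniqP _) ?filter_uniq //; apply/subset_leq_card/fintype.subsetP => i.
by rewrite inE mem_filter => /andP[].
Qed.

Definition position_lipschitz (L : forall n, 'S_n -> nat) :=
  forall n (s s' : 'S_n), (L n s <= L n s' + num_diff s s')%N.

Lemma LIS_lipschitz : position_lipschitz LIS.
Proof.
move=> n s s'; rewrite !LIS_chain.
by apply: (@chain_max_lipschitz _ (fun i j : 'I_n => i < j)%N) => j i k /=; apply: ltn_trans.
Qed.

Lemma LDS_lipschitz : position_lipschitz LDS.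
Proof.
move=> n s s'; rewrite !LDS_chain.
apply: (@chain_max_lipschitz _ (fun i j : 'I_n => j < i)%N) => j i k /= ji kj.
exact: ltn_trans kj ji.
Qed.

Lemma num_diff_tperm n (x y : 'I_n) (s : 'S_n) :
  (num_diff s (tperm x y * s)%g <= 2)%N.
Proof.
apply: leq_trans (_ : #|[set x; y]| <= 2)%N; last by rewrite cards2; case: eqP.
apply/subset_leq_card/fintype.subsetP => i; rewrite !inE permM.
by case: tpermP => [->|->|_ _]; rewrite ?eqxx ?orbT.
Qed.

(** Multiplying by a transposition of points in two different cycles merges these
    cycles and changes two values. *)
Lemma merge_cycles n (s : 'S_n) :
  exists c : 'S_n, [/\ (#|porbits c| <= 1)%N & (num_diff s c <= 2 * #|porbits s|)%N].
Proof.
have [k] := ubnP #|porbits s|; elim: k s => // k IHk s lt_k.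
case: (leqP #|porbits s| 1) => [s1|/card_gt1P[X [Y [/imsetP[x _ ->] /imsetP[y _ ->] xy]]]].
  exists s; split=> //; suff -> : num_diff s s = 0%N by [].
  by apply/eqP; rewrite cards_eq0; apply/eqP/setP => i; rewrite !inE eqxx.
rewrite eq_porbit_mem in xy.
have := porbits_mul_tperm s x y; rewrite xy /=.
have -> : x != y by apply: contraNneq xy => ->; apply: porbit_id.
rewrite addn1 -[1.*2]/2%N addn2 => -[merged].
have [|c [c1 sc]] := IHk (tperm x y * s)%g.
  by rewrite -ltnS merged.
exists c; split=> //; apply: leq_trans (num_diff_triangle s (tperm x y * s)%g c) _.
by apply: leq_trans (leq_add (num_diff_tperm x y s) sc) _; rewrite -merged mulnS.
Qed.

Definition std_cycle n : 'S_n := perm (@ordS_inj n).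

(** Number the points in the order in which the cycle visits them. *)
Lemma single_cycle_conj n (c : 'S_n) : (#|porbits c| <= 1)%N ->
  exists u : 'S_n, (c ^ u)%g = std_cycle n.
Proof.
case: n c => [|n] c c1.
  by exists 1%g; apply/permP => -[].
have porb0 x : x \in porbit c ord0.
  rewrite -eq_porbit_mem; apply/eqP.
  by apply: (card_le1_eqP c1); apply: imset_f.
have sz : #|porbit c ord0| = n.+1.
  by rewrite -[RHS]card_ord; apply: eq_card => x; rewrite porb0.
pose f (i : 'I_n.+1) := iter i c ord0.
have f_inj : injective f.
  have uniq_tr := uniq_traject_porbit c ord0; rewrite sz in uniq_tr.
  move=> i j; rewrite /f -(nth_traject c (ltn_ord i)) -(nth_traject c (ltn_ord j)).
  by move/eqP; rewrite nth_uniq ?size_traject ?ltn_ord // => /eqP/val_inj.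
have fS i : f (ordS i) = c (f i).
  rewrite /f /= -iterS; have := ltn_ord i; rewrite leq_eqVlt => /orP[/eqP iN|iN].
    by rewrite iN modnn; have := iter_porbit c ord0; rewrite sz => ->.
  by rewrite modn_small.
exists (perm f_inj)^-1%g; apply/permP => i.
apply: (@perm_inj _ (perm f_inj)).
by rewrite conjgE invgK !permM permKV !permE fS.
Qed.

Lemma near_std_cycle n (s : 'S_n) :
  exists u : 'S_n, (num_diff (s ^ u)%g (std_cycle n) <= 2 * ncycles s)%N.
Proof.
have [c [/single_cycle_conj[u cu] sc]] := merge_cycles s.
by exists u; rewrite -cu num_diff_conj.
Qed.

(** The cycles are disjoint, so a union of cycles determines them. *)
Lemma cover_sub n (s : 'S_n) (P Q : {set {set 'I_n}}) :
  P \subset porbits s -> Q \subset porbits s ->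
  finset.cover P = finset.cover Q -> P \subset Q.
Proof.
move=> /fintype.subsetP Ps /fintype.subsetP Qs PQ; apply/fintype.subsetP => X XP.
have /imsetP[x _ XE] := Ps _ XP.
have : x \in finset.cover Q.
  by rewrite -PQ; apply/bigcupP; exists X; rewrite // XE porbit_id.
case/bigcupP => Y YQ xY; have /imsetP[y _ YE] := Qs _ YQ.
suff -> : X = Y by [].
by apply/eqP; rewrite XE YE eq_porbit_mem -YE.
Qed.

(** Each union of cycles is an invariant set. *)
Lemma cycle_unions_invariant n (s : 'S_n) :
  (2 ^ ncycles s <= #|[set A : {set 'I_n} | s @: A == A]|)%N.
Proof.
rewrite /ncycles -card_powerset.
have inj : {in powerset (porbits s) &, injective (@finset.cover 'I_n)}.
  move=> P Q; rewrite !inE => Ps Qs PQ.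
  by apply/eqP; rewrite finset.eqEsubset (cover_sub Ps Qs PQ) (cover_sub Qs Ps (esym PQ)).
rewrite -(card_in_imset inj); apply/subset_leq_card/fintype.subsetP => A.
case/imsetP => P; rewrite !inE => /fintype.subsetP Ps ->.
rewrite eqEcard card_imset ?leqnn ?andbT; last exact: perm_inj.
apply/fintype.subsetP => i /imsetP[j /bigcupP[X XP jX] ->].
apply/bigcupP; exists X => //; have /imsetP[x _ XE] := Ps _ XP.
move: jX; rewrite XE -!eq_porbit_mem => /eqP <-; rewrite eq_porbit_mem.
exact: (mem_porbit s 1).
Qed.

(** List the elements of [A] first, then the others. *)
Lemma perm_to_initial_segment n (A : {set 'I_n}) :
  exists u : 'S_n, u @: A = [set i : 'I_n | (i < #|A|)%N].
Proof.
pose l := enum A ++ enum (~: A).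
have l_mem i : i \in l by rewrite mem_cat !mem_enum inE orbN.
have sz_l : size l = n.
  by rewrite size_cat -!cardE cardsC card_ord.
have idx i : (index i l < n)%N by have := index_mem i l; rewrite l_mem sz_l.
have idx_inj : injective (fun i => Ordinal (idx i)).
  by move=> i j /(congr1 val) /= ij; exact: (index_inj i (l_mem i) (l_mem j) ij).
exists (perm idx_inj); apply/eqP.
rewrite eqEcard card_imset; last exact: perm_inj.
apply/andP; split.
  apply/fintype.subsetP => i /imsetP[j jA ->]; rewrite inE permE /=.
  by rewrite /l index_cat mem_enum jA cardE index_mem mem_enum.
rewrite -sum1_card (eq_bigl (fun i : 'I_n => (i < #|A|)%N)) => [|i]; last by rewrite inE.
have An : (#|A| <= n)%N by rewrite -[X in (_ <= X)%N](card_ord n) max_card.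
by rewrite -(big_ord_widen n (fun=> 1%N) An) sum1_card card_ord.
Qed.

(** Burnside's lemma for the action on the subsets, which has one orbit for each
    cardinality. *)
Lemma sum_exp2_cycles n : (\sum_(s : 'S_n) 2 ^ ncycles s <= n.+1 * n`!)%N.
Proof.
pose to := ('P^* : {action 'S_n &-> {set 'I_n}})%act.
have acts : [acts [set: 'S_n], on [set: {set 'I_n}] | to].
  by apply/actsP => s _ A; rewrite !inE.
have := Frobenius_Cauchy acts; rewrite cardsT card_Sn => FC.
apply: leq_trans (_ : \sum_(s in [set: 'S_n]) #|'Fix_([set: {set 'I_n}] | to)[s]%g| <= _)%N.
  rewrite big_mkcond [leqRHS]big_mkcond /=; apply: leq_sum => s _; rewrite inE.
  apply: leq_trans (cycle_unions_invariant s) _.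
  apply/subset_leq_card/fintype.subsetP => A; rewrite inE => sA.
  by rewrite !inE /= finset.sub1set inE /=. 
rewrite FC leq_mul2r; apply/orP; right.
pose seg (k : 'I_n.+1) := [set i : 'I_n | (i < k)%N].
apply: leq_trans (_ : #|[set orbit to [set: 'S_n] (seg k) | k : 'I_n.+1]| <= _)%N; last first.
  by rewrite -[leqRHS]card_ord leq_imset_card.
apply/subset_leq_card/fintype.subsetP => _ /imsetP[A _ ->].
have An : (#|A| < n.+1)%N by rewrite ltnS -[leqRHS]card_ord max_card.
apply/imsetP; exists (Ordinal An) => //.
have [u uA] := perm_to_initial_segment A.
apply/orbit_eqP; rewrite /seg /= -uA.
by rewrite orbit_sym; apply/orbitP; exists u; rewrite ?inE.
Qed.

(** * Concentration for uniform cycles *)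

(** The factor [2] is the one of [near_std_cycle]. *)
Definition many_cycles (R : realType) (e : R) n (s : 'S_n) : bool :=
  e * Num.sqrt n%:R < (2 * ncycles s)%:R.

(** Markov's inequality for [2 ^ #(s)], which is at least [expR (#(s) / 2)]. *)
Lemma many_cycles_rapid (R : realType) (e : R) : 0 < e ->
  rapid (fun n => prob (@perm_mean R n) (@many_cycles R e n)).
Proof.
move=> e0; apply: (@rapid_exp_sqrt _ _ 2 (e / 4) 1 1); first by rewrite divr_gt0.
  by move=> n; apply: prob_le1 (perm_expectation R n).
move=> n n1; have eP := perm_expectation R n.
set N : R := Num.sqrt n%:R.
have nf0 : 0 < (n`!)%:R :> R by rewrite ltr0n fact_gt0.
have half : expR (1 / 2) <= 2 :> R.
  have := @expR_quad R (1 / 2); rewrite ger0_norm; last lra.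
  by move=> /(_ (lexx _)) /le_trans; apply; lra.
apply: le_trans (_ : expR (- (e / 4 * N)) * perm_mean (fun s : 'S_n => 2 ^+ ncycles s) <= _).
  rewrite -(meanZ _ _ eP); apply: (mean_le eP) => s _.
  rewrite /many_cycles -/N; case: ltP => [many|_] /=; last first.
    by rewrite mulr_ge0 ?expR_ge0 ?exprn_ge0.
  apply: le_trans (_ : expR (- (e / 4 * N)) * expR (1 / 2) ^+ ncycles s <= _).
    rewrite -expRM_natl -expRD -[leLHS]expR0 ler_expR.
    by move: many; rewrite natrM; lra.
  by rewrite ler_wpM2l ?expR_ge0 // lerXn2r ?nnegrE ?expR_ge0.
rewrite mulrC ler_wpM2r ?expR_ge0 // expr1 /perm_mean ler_pdivrMl //.
have := sum_exp2_cycles n; rewrite -(ler_nat R) natr_sum.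
under eq_bigr do rewrite natrX.
move=> /le_trans; apply; rewrite natrM mulrC (ler_wpM2l (ltW nf0)) //.
by rewrite -natrM ler_nat; lia.
Qed.

Lemma deviates_lipschitz (R : realType) (L : forall n, 'S_n -> nat) (e : R) n
    (s s' : 'S_n) k :
  position_lipschitz L -> (num_diff s s' <= k)%N -> deviates (e + e) n (L n s) ->
  deviates e n (L n s') || (e * Num.sqrt n%:R < k%:R).
Proof.
move=> Llip ss'; rewrite /deviates; set N := Num.sqrt _.
have le1 : (L n s)%:R <= (L n s')%:R + k%:R :> R.
  by rewrite -natrD ler_nat (leq_trans (Llip _ s s')) // leq_add2l.
have le2 : (L n s')%:R <= (L n s)%:R + k%:R :> R.
  by rewrite -natrD ler_nat (leq_trans (Llip _ s' s)) // leq_add2l num_diffC.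
rewrite !ltr_normr => dev; case: (ltP (e * N) k%:R) => [|kN]; first by rewrite orbT.
by rewrite orbF; case/orP: dev => dev; apply/orP; [left|right]; lra.
Qed.

Lemma perm_mean_mulr (R : realType) n (v : 'S_n) (F : 'S_n -> R) :
  perm_mean (fun s => F (s * v)%g) = perm_mean F.
Proof. by congr (_ * _); rewrite [RHS](reindex_inj (mulIg v)). Qed.

Lemma perm_mean_mull (R : realType) n (v : 'S_n) (F : 'S_n -> R) :
  perm_mean (fun s => F (v * s)%g) = perm_mean F.
Proof. by congr (_ * _); rewrite [RHS](reindex_inj (mulgI v)). Qed.

Lemma perm_mean_conj (R : realType) n (v : 'S_n) (F : 'S_n -> R) :
  perm_mean (fun s => F (s ^ v)%g) = perm_mean F.
Proof. by congr (_ * _); rewrite [RHS](reindex_inj (conjg_inj v)). Qed.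

Lemma conj_to_std_cycle n (s : 'S_n) : exists v : 'S_n,
  forall u : 'S_n, (num_diff (s ^ (v * u))%g (std_cycle n ^ u)%g <= 2 * ncycles s)%N.
Proof.
have [v sv] := near_std_cycle s.
by exists v => u; rewrite conjgM num_diff_conj.
Qed.

(** For each [s], the uniform n-cycle is close to a uniform conjugate of [s].
    Averaging over a uniform [s], the conjugate becomes a uniform permutation. *)
Lemma cycle_concentration (R : realType) (L : forall n, 'S_n -> nat) :
  position_lipschitz L ->
  (forall e : R, 0 < e -> rapid (fun n => prob (@perm_mean R n) (fun s => deviates e n (L n s)))) ->
  forall e : R, 0 < e ->
  rapid (fun n => prob (@perm_mean R n) (fun u => deviates e n (L n (std_cycle n ^ u)%g))).
Proof.
move=> Llip Lconc e e0; have e20 : 0 < e / 2 by rewrite divr_gt0.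
apply: rapid_le (rapidD (Lconc _ e20) (many_cycles_rapid e20)) => n.
have eP := perm_expectation R n.
have one_perm (s : 'S_n) :
    prob (@perm_mean R n) (fun u => deviates e n (L n (std_cycle n ^ u)%g)) <=
    prob (@perm_mean R n) (fun u => deviates (e / 2) n (L n (s ^ u)%g)) +
    (many_cycles (e / 2) s)%:R.
  have [v near_v] := conj_to_std_cycle s.
  rewrite /prob -[X in _ <= X + _](perm_mean_mull v) -[X in _ <= _ + X](mean_cst _ eP).
  rewrite -(meanD _ _ eP); apply: (mean_le eP) => u _.
  have := @deviates_lipschitz R L (e / 2) n (std_cycle n ^ u)%g (s ^ (v * u))%g (2 * ncycles s) Llip.
  rewrite num_diffC near_v -splitr => /(_ isT) dev.
  rewrite -natrD ler_nat; case: (deviates e n _) dev => // /(_ isT).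
  by rewrite /many_cycles; case: deviates => //= ->.
apply: le_trans (_ : perm_mean (fun s : 'S_n =>
  prob (@perm_mean R n) (fun u => deviates (e / 2) n (L n (s ^ u)%g)) +
    (many_cycles (e / 2) s)%:R) <= _).
  by rewrite -[leLHS](mean_cst _ eP); apply: (mean_le eP) => s _.
rewrite (meanD _ _ eP) lerD2r /prob.
(* For a fixed [u], conjugation by [u] preserves the uniform law of [s]. *)
rewrite [leLHS](_ : _ = perm_mean (fun u : 'S_n =>
    perm_mean (fun s : 'S_n => (deviates (e / 2) n (L n (s ^ u)%g))%:R))).
  rewrite -[leRHS](mean_cst _ eP); apply: (mean_le eP) => u _.
  by rewrite (perm_mean_conj u (fun s : 'S_n => (deviates (e / 2) n (L n s))%:R)).
rewrite /perm_mean -!mulr_sumr; congr (_ * _); congr (_ * _).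
by rewrite exchange_big.
Qed.

(** Reversing the order of the values exchanges LDS and LIS. *)
Lemma LDS_LIS_rev n (s : 'S_n) :
  LDS s = LIS (s * perm (@rev_ord_inj n))%g.
Proof.
rewrite LDS_chain LIS_chain; apply: eq_chain_max => i j.
rewrite !permM !permE /=; have := ltn_ord (s i); have := ltn_ord (s j); lia.
Qed.

Lemma LDS_concentration (R : realType) (e : R) : 0 < e ->
  rapid (fun n => prob (@perm_mean R n) (fun s => deviates e n (LDS s))).
Proof.
move=> /LIS_concentration; apply: rapid_le => n.
rewrite /prob -[leRHS](perm_mean_mulr (perm (@rev_ord_inj n))).
by apply: (mean_le (perm_expectation R n)) => s _; rewrite LDS_LIS_rev.
Qed.

Local Open Scope classical_set_scope.
Local Open Scope ring_scope.

(** * Conjugation invariant laws on permutations *)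

Definition vanishes (R : realType) (u : nat -> R) : Prop :=
  forall e : R, 0 < e -> \forall n \near \oo, u n < e.

Lemma vanishesP (R : realType) (u : nat -> R) : (forall n, 0 <= u n) ->
  ((u n)%:E @[n --> \oo] --> 0%E) <-> vanishes u.
Proof.
move=> u0; split=> [/fine_cvg/cvgr0Pnorm_lt u_lt e e0|u_lt].
  by near=> n; rewrite -(ger0_norm (u0 n)); near: n; apply: u_lt.
apply: cvg_EFin; first exact: nearW.
apply/cvgr0Pnorm_lt => e e0; near=> n.
by rewrite /= (ger0_norm (u0 n)); near: n; apply: u_lt.
Unshelve. all: by end_near. Qed.

Lemma vanishes_le (R : realType) (u v : nat -> R) :
  (forall n, (0 < n)%N -> u n <= v n) -> vanishes v -> vanishes u.
Proof.
move=> uv v_lt e e0; near=> n; apply: le_lt_trans (uv n _) _.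
  by near: n; exact: nbhs_infty_ge.
by near: n; apply: v_lt.
Unshelve. all: by end_near. Qed.

Lemma vanishesD (R : realType) (u v : nat -> R) :
  vanishes u -> vanishes v -> vanishes (fun n => u n + v n).
Proof.
move=> u_lt v_lt e e0; have e20 : 0 < e / 2 by rewrite divr_gt0.
near=> n; rewrite (splitr e) ltrD //; near: n; [exact: u_lt|exact: v_lt].
Unshelve. all: by end_near. Qed.

Lemma vanishesZ (R : realType) (c : R) (u : nat -> R) : 0 < c ->
  vanishes u -> vanishes (fun n => c * u n).
Proof.
move=> c0 u_lt e e0; near=> n.
by rewrite -ltr_pdivlMl // mulrC; near: n; apply: u_lt; rewrite divr_gt0.
Unshelve. all: by end_near. Qed.

Lemma rapid_vanishes (R : realType) (r : nat -> R) k : rapid r ->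
  vanishes (fun n => n%:R ^+ k * r n).
Proof.
move=> rr e e0; have [C rC] := rr k.+1; near=> n.
have n0 : 0 < n%:R :> R by rewrite ltr0n; near: n; exact: nbhs_infty_ge.
rewrite -(ltr_pM2l n0) mulrA -exprS; apply: le_lt_trans (rC n) _.
rewrite -ltr_pdivrMr //; near: n; exact: nbhs_infty_gtr.
Unshelve. all: by end_near. Qed.

Lemma vanishes_powR (R : realType) (u : nat -> R) p : 0 < p ->
  (forall n, 0 <= u n) -> vanishes u -> vanishes (fun n => u n `^ p).
Proof.
move=> p0 u0 u_lt e e0; near=> n.
have -> : e = (e `^ p^-1) `^ p.
  by rewrite -powRrM mulVf ?lt0r_neq0 // powRr1 // ltW.
rewrite gt0_ltr_powR ?nnegrE ?powR_ge0 //.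
by near: n; apply: u_lt; rewrite powR_gt0.
Unshelve. all: by end_near. Qed.

Definition law_weight (R : realType) d (T : measurableType d)
    (P : probability T R) n (X : {RV P >-> 'S_n}) (s : 'S_n) : R :=
  fine (P (X @^-1` [set s])).

Definition law_mean (R : realType) d (T : measurableType d)
    (P : probability T R) n (X : {RV P >-> 'S_n}) (F : 'S_n -> R) : R :=
  \sum_(s : 'S_n) law_weight X s * F s.

Lemma integral_law (R : realType) d (T : measurableType d)
    (P : probability T R) n (X : {RV P >-> 'S_n}) (g : 'S_n -> R) :
  (forall s, 0 <= g s) ->
  (\int[P]_w (g (X w))%:E)%E = (law_mean X g)%:E.
Proof.
move=> g0.
have mX (s : 'S_n) : measurable (X @^-1` [set s]) by exact: measurable_funPTI.
under eq_integral => w _.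
  have -> : (g (X w))%:E = (\sum_(s : 'S_n) (g s)%:E * (\1_(X @^-1` [set s]) w)%:E)%E.
    rewrite (bigD1 (X w)) //= indicE mem_set // mule1 big1 ?adde0 // => s sX.
    by rewrite indicE memNset ?mule0 //= => /esym/eqP; rewrite (negbTE sX).
  over.
rewrite ge0_integral_sum //; last 2 first.
- move=> s; apply: emeasurable_funM => //.
  by apply/measurable_realfun.measurable_EFinP; exact: measurable_realfun.measurable_indic.
- by move=> s w _; rewrite -EFinM lee_fin mulr_ge0 // indicE ler0n.
rewrite /law_mean -sumEFin; apply: eq_bigr => s _.
rewrite ge0_integralZl_EFin //; last first.
- by apply/measurable_realfun.measurable_EFinP; exact: measurable_realfun.measurable_indic.
rewrite integral_indic // setIT EFinM muleC; congr (_ * _)%E.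
by rewrite /law_weight fineK // fin_num_measure.
Qed.

Lemma probability_law (R : realType) d (T : measurableType d)
    (P : probability T R) n (X : {RV P >-> 'S_n}) (A : 'S_n -> bool) :
  P [set w | A (X w)] = (prob (law_mean X) A)%:E.
Proof.
have mA : measurable [set w | A (X w)].
  by rewrite -[X in measurable X]/(X @^-1` [set s | A s]); exact: measurable_funPTI.
rewrite /prob -integral_law // -[in LHS](setIT [set w | A (X w)]).
rewrite -integral_indic //; apply: eq_integral => w _.
by rewrite indicE; case: (boolP (A (X w))) => AX; [rewrite mem_set|rewrite memNset //=; apply/negP].
Qed.

Lemma law_expectation (R : realType) d (T : measurableType d)
    (P : probability T R) n (X : {RV P >-> 'S_n}) :
  expectation predT (law_mean X).
Proof.
split; rewrite /law_mean.
- move=> F G FG; apply: ler_sum => s _; rewrite ler_wpM2l ?FG //.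
  by rewrite fine_ge0.
- by move=> c F G; rewrite mulr_sumr -big_split; apply: eq_bigr => s _ /=; ring.
- have := @integral_law _ _ _ _ _ X (fun=> 1) (fun=> ler01).
  rewrite integral_cst // mul1e => total; apply: EFin_inj.
  by rewrite -total; exact: probability_setT.
Qed.

Definition conj_invariant_law (R : realType) d (T : measurableType d)
    (P : probability T R) n (X : {RV P >-> 'S_n}) : Prop :=
  forall u s : 'S_n, law_weight X (s ^ u)%g = law_weight X s.

Lemma conj_invariant_lawP (R : realType) d (T : measurableType d)
    (P : probability T R) n (X : {RV P >-> 'S_n}) :
  (forall s : 'S_n, pushforward P (fun w => s^-1 * X w * s)%g = distribution P X) ->
  conj_invariant_law X.
Proof.
move=> inv u s; rewrite /law_weight; congr fine.
have /(congr1 (fun mu => mu [set (s ^ u)%g])) := inv u.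
move=> /= H; apply: (etrans (esym H)); rewrite /pushforward /=; congr (P _).
apply/seteqP; split => w /=; rewrite conjgE mulgA; last by move=> ->.
by move=> /mulIg/mulgI.
Qed.

Lemma law_mean_average (R : realType) d (T : measurableType d)
    (P : probability T R) n (X : {RV P >-> 'S_n}) F : conj_invariant_law X ->
  law_mean X F = law_mean X (fun s => perm_mean (fun u => F (s ^ u)%g)).
Proof.
move=> inv; have eP := perm_expectation R n; have eX := law_expectation X.
transitivity (perm_mean (fun u : 'S_n => law_mean X (fun s => F (s ^ u)%g))).
  rewrite -[LHS](mean_cst _ eP); apply: (mean_eq eP) => u _.
  rewrite /law_mean (reindex_inj (conjg_inj u)).
  by apply: eq_bigr => s _; rewrite inv.
rewrite [in LHS]/law_mean (mean_sum _ _ eP).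
by apply: eq_bigr => s _; rewrite (meanZ _ _ eP).
Qed.

(** Average over the conjugates of [s], then choose the conjugate close to the
    standard cycle: the comparison only costs a term that depends on the number
    of cycles of [s]. *)
Lemma law_mean_le_cycle (R : realType) d (T : measurableType d)
    (P : probability T R) n (X : {RV P >-> 'S_n}) F G B : conj_invariant_law X ->
  (forall s s' u : 'S_n, (num_diff s' (std_cycle n ^ u)%g <= 2 * ncycles s)%N ->
    F s' <= G (std_cycle n ^ u)%g + B s) ->
  law_mean X F <= perm_mean (fun u => G (std_cycle n ^ u)%g) + law_mean X B.
Proof.
move=> inv FGB; have eP := perm_expectation R n; have eX := law_expectation X.
rewrite (law_mean_average F inv) -[X in _ <= X + _](mean_cst _ eX) -(meanD _ _ eX).
apply: (mean_le eX) => s _; have [v near_v] := conj_to_std_cycle s.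
rewrite -(perm_mean_mull v) -[X in _ <= _ + X](mean_cst _ eP) -(meanD _ _ eP).
by apply: (mean_le eP) => u _; apply: FGB.
Qed.

(** * Convergence in probability and in L^p *)

Definition scaled (R : realType) n (x : nat) : R := x%:R / Num.sqrt n%:R.

Lemma sqrtn_gt0 (R : realType) n : (0 < n)%N -> 0 < Num.sqrt n%:R :> R.
Proof. by rewrite sqrtr_gt0 ltr0n. Qed.

Lemma deviatesE (R : realType) (e : R) n x : (0 < n)%N ->
  (e < `|scaled R n x - 2|) = deviates e n x.
Proof.
move=> /(sqrtn_gt0 R) N0; rewrite /deviates /scaled.
rewrite -(ltr_pM2r N0) -{3}(gtr0_norm N0) -normrM mulrBl divfK //.
exact: lt0r_neq0.
Qed.

Lemma many_cyclesE (R : realType) (e : R) n (s : 'S_n) : (0 < n)%N ->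
  (e / 2 < `|scaled R n (ncycles s) - 0|) = many_cycles e s.
Proof.
move=> /(sqrtn_gt0 R) N0; rewrite /many_cycles /scaled subr0.
rewrite ger0_norm ?divr_ge0 ?ler0n ?sqrtr_ge0 // ltr_pdivlMr // natrM.
by rewrite -[RHS](ltr_pM2l (x := 2^-1)) ?invr_gt0 // mulKf // mulrA [e / 2]mulrC.
Qed.

Lemma cvg_in_probabilityP (R : realType) (d : nat -> measure_display)
    (T : forall n, measurableType (d n)) (P : forall n, probability (T n) R)
    (sigma : forall n, {RV (P n) >-> 'S_n}) (f : forall n, 'S_n -> nat) (c : R) :
  cvg_in_probability P (fun n w => scaled R n (f n (sigma n w))) c <->
  forall e : R, 0 < e -> vanishes (fun n =>
    prob (law_mean (sigma n)) (fun s => e < `|scaled R n (f n s) - c|)).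
Proof.
have E (e : R) n : P n [set w | e < `|scaled R n (f n (sigma n w)) - c|] =
    (prob (law_mean (sigma n)) (fun s => e < `|scaled R n (f n s) - c|))%:E.
  exact: (probability_law (sigma n) (fun s => e < `|scaled R n (f n s) - c|)).
split=> cvg e e0.
  apply/vanishesP => [n|]; first exact: prob_ge0 (law_expectation _).
  by have := cvg e e0; under eq_fun do rewrite E.
under eq_fun do rewrite E.
by apply/vanishesP => [n|]; [exact: prob_ge0 (law_expectation _)|exact: cvg].
Qed.

(** What the proof uses of LIS and LDS. *)
Record concentrated_on_cycles (R : realType) (L : forall n, 'S_n -> nat) : Prop := {
  stable_lipschitz : position_lipschitz L;
  stable_le : forall n (s : 'S_n), (L n s <= n)%N;
  stable_conc : forall e : R, 0 < e -> rapid (fun n =>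
    prob (@perm_mean R n) (fun u => deviates e n (L n (std_cycle n ^ u)%g))) }.

Lemma cvg_in_probability_stable (R : realType) (d : nat -> measure_display)
    (T : forall n, measurableType (d n)) (P : forall n, probability (T n) R)
    (sigma : forall n, {RV (P n) >-> 'S_n}) (L : forall n, 'S_n -> nat) :
  conjugation_invariant sigma -> concentrated_on_cycles R L ->
  cvg_in_probability P (fun n w => scaled R n (ncycles (sigma n w))) 0 ->
  cvg_in_probability P (fun n w => scaled R n (L n (sigma n w))) 2.
Proof.
move=> inv [Llip _ Lconc] /cvg_in_probabilityP cyc; apply/cvg_in_probabilityP => e e0.
have e20 : 0 < e / 2 by rewrite divr_gt0.
have e40 : 0 < e / 2 / 2 by rewrite divr_gt0.
apply: vanishes_le (vanishesD (rapid_vanishes 0 (Lconc _ e20)) (cyc _ e40)) => n n0.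
rewrite expr0 mul1r.
apply: (law_mean_le_cycle (G := fun s => (deviates (e / 2) n (L n s))%:R)).
  by apply: conj_invariant_lawP => s; exact: inv.
move=> s s' u near_u; rewrite deviatesE // many_cyclesE //.
have := deviates_lipschitz (e := e / 2) Llip near_u; rewrite -splitr -natrD ler_nat.
case: (deviates e n _) => // /(_ isT).
by rewrite /many_cycles; case: deviates => //= ->.
Qed.

Lemma Lnorm_law (R : realType) d (T : measurableType d)
    (P : probability T R) n (X : {RV P >-> 'S_n}) (p : R) (h : 'S_n -> R) :
  Lnorm P p%:E (fun w => (h (X w))%:E) =
  (law_mean X (fun s => `|h s| `^ p) `^ p^-1)%:E.
Proof.
by rewrite unlock -poweR_EFin -integral_law.
Qed.

Lemma powR_vanishes (R : realType) (u : nat -> R) p : 0 < p ->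
  (forall n, 0 <= u n) -> vanishes (fun n => u n `^ p^-1) -> vanishes u.
Proof.
move=> p0 u0 /(vanishes_powR p0 (fun n => powR_ge0 _ _)).
apply: vanishes_le => n _; rewrite -powRrM mulVf ?lt0r_neq0 // powRr1 //.
Qed.

Lemma cvg_in_LpP (R : realType) (d : nat -> measure_display)
    (T : forall n, measurableType (d n)) (P : forall n, probability (T n) R)
    (sigma : forall n, {RV (P n) >-> 'S_n}) (f : forall n, 'S_n -> nat) (p c : R) :
  0 < p ->
  cvg_in_Lp P p (fun n w => scaled R n (f n (sigma n w))) c <->
  vanishes (fun n => law_mean (sigma n) (fun s => `|scaled R n (f n s) - c| `^ p)).
Proof.
move=> p0.
have E n : Lnorm (P n) p%:E (fun w => (scaled R n (f n (sigma n w)) - c)%:E) =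
    (law_mean (sigma n) (fun s => `|scaled R n (f n s) - c| `^ p) `^ p^-1)%:E.
  exact: (Lnorm_law (sigma n) p (fun s => scaled R n (f n s) - c)).
have m0 n : 0 <= law_mean (sigma n) (fun s => `|scaled R n (f n s) - c| `^ p).
  rewrite -(mean_cst 0 (law_expectation (sigma n))).
  by apply: (mean_le (law_expectation (sigma n))) => s _; exact: powR_ge0.
rewrite /cvg_in_Lp; under eq_fun do rewrite E.
split=> [/vanishesP cvg|cvg].
  by apply: (powR_vanishes p0) => //; apply: cvg => n; exact: powR_ge0.
apply/vanishesP => [n|]; first exact: powR_ge0.
by apply: vanishes_powR; rewrite ?invr_gt0.
Qed.

Lemma powRD_le (R : realType) (x y p : R) : 0 <= x -> 0 <= y -> 0 <= p ->
  (x + y) `^ p <= 2 `^ p * (x `^ p + y `^ p).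
Proof.
move=> x0 y0 p0; wlog xy : x y x0 y0 / x <= y => [wlog_xy|].
  by case: (leP x y) => [|/ltW] xy; [|rewrite addrC [x `^ p + _]addrC]; exact: wlog_xy.
apply: le_trans (_ : (2 * y) `^ p <= _).
  by rewrite ge0_ler_powR // ?nnegrE ?addr_ge0 ?mulr_ge0 //; lra.
by rewrite powRM // ler_wpM2l ?powR_ge0 // lerDr powR_ge0.
Qed.

(** Where the deviation is at most [e1] its power is small; elsewhere it is at
    most polynomial in [n], on an event of rapidly decreasing probability. *)
Lemma cycle_moment_vanishes (R : realType) (L : forall n, 'S_n -> nat) (p : R) :
  1 <= p -> concentrated_on_cycles R L ->
  vanishes (fun n => perm_mean (fun u : 'S_n =>
    `|scaled R n (L n (std_cycle n ^ u)%g) - 2| `^ p)).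
Proof.
move=> p1 [_ Lle Lconc] e e0; have p0 : 0 < p by apply: lt_le_trans p1.
pose e1 := (e / 2) `^ p^-1; have e10 : 0 < e1 by rewrite powR_gt0 // divr_gt0.
have e1E : e1 `^ p = e / 2.
  by rewrite -powRrM mulVf ?lt0r_neq0 // powRr1 // ltW // divr_gt0.
pose k := (Num.truncn p).+1.
have pk : p <= k%:R by rewrite ltW // truncnS_gt.
have van := vanishesZ (_ : 0 < 3 ^+ k) (rapid_vanishes k (Lconc _ e10)).
near=> n; have n0 : (0 < n)%N by near: n; exact: nbhs_infty_ge.
have n1 : 1 <= n%:R :> R by rewrite ler1n.
have eP := perm_expectation R n.
apply: le_lt_trans (_ : e / 2 + 3 ^+ k * (n%:R ^+ k * prob (@perm_mean R n)
  (fun u => deviates e1 n (L n (std_cycle n ^ u)%g))) < _); last first.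
  rewrite [ltRHS](splitr e) ltrD2l; near: n; apply: van; first by rewrite exprn_gt0.
  by rewrite divr_gt0.
rewrite -[X in _ <= X + _](mean_cst _ eP) mulrA /prob -(meanZ _ _ eP) -(meanD _ _ eP).
apply: (mean_le eP) => u _; set l := L n _.
rewrite -(deviatesE e1 l n0); case: ltP => [_|small] /=; last first.
  by rewrite mulr0 addr0 -e1E ge0_ler_powR // ?nnegrE ?ltW.
rewrite mulr1 -exprMn -powR_mulrn ?mulr_ge0 //.
apply: le_trans (_ : (3 * n%:R) `^ p <= _); last first.
  apply: le_trans (ler_powR _ pk) _; first lra.
  by rewrite lerDr divr_ge0 // ltW.
rewrite ge0_ler_powR // ?nnegrE ?mulr_ge0 //; first exact: ltW.
have sq1 : 1 <= Num.sqrt n%:R :> R by rewrite -[leLHS]sqrtr1 ler_wsqrtr.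
have l0 : 0 <= scaled R n l by rewrite divr_ge0 ?ler0n ?sqrtr_ge0.
have ln : scaled R n l <= n%:R.
  rewrite ler_pdivrMr ?sqrtn_gt0 //; apply: le_trans (_ : n%:R * 1 <= _).
    by rewrite mulr1 ler_nat Lle.
  by rewrite ler_wpM2l.
by rewrite ler_norml; apply/andP; split; lra.
Unshelve. all: by end_near. Qed.

Lemma cvg_in_Lp_stable (R : realType) (d : nat -> measure_display)
    (T : forall n, measurableType (d n)) (P : forall n, probability (T n) R)
    (sigma : forall n, {RV (P n) >-> 'S_n}) (L : forall n, 'S_n -> nat) (p : R) :
  1 <= p -> conjugation_invariant sigma -> concentrated_on_cycles R L ->
  cvg_in_Lp P p (fun n w => scaled R n (ncycles (sigma n w))) 0 ->
  cvg_in_Lp P p (fun n w => scaled R n (L n (sigma n w))) 2.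
Proof.
move=> p1 inv Lst; have p0 : 0 < p by apply: lt_le_trans p1.
have [Llip _ _] := Lst.
move=> /(cvg_in_LpP _ _ _ p0) cyc; apply/(cvg_in_LpP _ _ _ p0).
have two0 : 0 < 2 `^ p :> R by rewrite powR_gt0.
have van := vanishesD (vanishesZ two0 (cycle_moment_vanishes p1 Lst))
  (vanishesZ (mulr_gt0 two0 two0) cyc).
apply: vanishes_le van => n n0.
rewrite -(meanZ _ _ (perm_expectation R n)) -(meanZ _ _ (law_expectation _)).
apply: (law_mean_le_cycle (G := fun s => 2 `^ p * `|scaled R n (L n s) - 2| `^ p)).
  by apply: conj_invariant_lawP => s; exact: inv.
move=> s s' u near_u; set v := (std_cycle n ^ u)%g in near_u *.
have N0 := sqrtn_gt0 R n0.
rewrite -mulrA -mulrDr -powRM // subr0.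
apply: le_trans (powRD_le _ _ (ltW p0)) => //.
rewrite ge0_ler_powR // ?nnegrE ?addr_ge0 ?mulr_ge0 //; first exact: ltW.
have diff : `|scaled R n (L n s') - scaled R n (L n v)| <= 2 * `|scaled R n (ncycles s)|.
  rewrite /scaled -mulrBl !normrM mulrA ler_wpM2r //.
  rewrite [`|(ncycles s)%:R|]ger0_norm // -natrM.
  have := Llip n s' v; have := Llip n v s'; rewrite num_diffC => h1 h2.
  rewrite ler_norml !lerBDr; apply/andP; split.
    rewrite addrC lerBlDr -natrD ler_nat; lia.
  by rewrite -natrD ler_nat; lia.
have -> : scaled R n (L n s') - 2 =
  (scaled R n (L n v) - 2) + (scaled R n (L n s') - scaled R n (L n v)) by ring.
by apply: le_trans (ler_normD _ _) _; rewrite lerD2l.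
Qed.

Lemma chain_max_le n (r : rel 'I_n) : (chain_max r <= n)%N.
Proof. by apply/bigmax_leqP => k _; rewrite -ltnS ltn_ord. Qed.

Lemma LIS_stable (R : realType) : concentrated_on_cycles R LIS.
Proof.
split; [exact: LIS_lipschitz|by move=> n s; rewrite LIS_chain chain_max_le|].
exact: (cycle_concentration LIS_lipschitz (@LIS_concentration R)).
Qed.

Lemma LDS_stable (R : realType) : concentrated_on_cycles R LDS.
Proof.
split; [exact: LDS_lipschitz|by move=> n s; rewrite LDS_chain chain_max_le|].
exact: (cycle_concentration LDS_lipschitz (@LDS_concentration R)).
Qed.

Theorem theorem8 (R : realType) (d : nat -> measure_display)
    (T : forall n, measurableType (d n)) (P : forall n, probability (T n) R)
    (sigma : forall n, {RV (P n) >-> 'S_n})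
    (sigma_inv : conjugation_invariant sigma) :
  (cvg_in_probability P
     (fun n w => (ncycles (sigma n w))%:R / Num.sqrt n%:R) 0 ->
   cvg_in_probability P
     (fun n w => (LIS (sigma n w))%:R / Num.sqrt n%:R) 2 /\
   cvg_in_probability P
     (fun n w => (LDS (sigma n w))%:R / Num.sqrt n%:R) 2)
  /\
  (forall p : R, 1 <= p ->
   cvg_in_Lp P p
     (fun n w => (ncycles (sigma n w))%:R / Num.sqrt n%:R) 0 ->
   cvg_in_Lp P p
     (fun n w => (LIS (sigma n w))%:R / Num.sqrt n%:R) 2 /\
   cvg_in_Lp P p
     (fun n w => (LDS (sigma n w))%:R / Num.sqrt n%:R) 2).
Proof.
split=> [cyc|p p1 cyc]; split.
- exact: (cvg_in_probability_stable sigma_inv (LIS_stable R) cyc).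
- exact: (cvg_in_probability_stable sigma_inv (LDS_stable R) cyc).
- exact: (cvg_in_Lp_stable p1 sigma_inv (LIS_stable R) cyc).
- exact: (cvg_in_Lp_stable p1 sigma_inv (LDS_stable R) cyc).
Qed.
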